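(* Let $\mathfrak g$ be one of the types $A_{2n-1}$ ($n\ge3$), $D_{n+1}$ ($n\ge2$), $A_{2n}$ ($n\ge2$), each with $r=2$, or $D_4$ (with $n=2$, $r=3$, $\omega=e^{2\pi\sqrt{-1}/3}$). Let $t(\mathfrak g)$ be the twisted toroidal Lie algebra given by the presentation in the context and $V$ the fermionic Fock space of the context. Letting $\not{c}$ act as the identity, the following assignment defines a level $(1,0)$ representation of $t(\mathfrak g)$ on $V$. **$X(\pm\alpha_0,z)$:** - $A_{2n-1}$: $X(\alpha_0,z)=:\!\varepsilon_{\bar2}(z)\beta^*(z)\!:+:\!\varepsilon_2^*(z)\varepsilon_{\bar1}(z)\!:$, $\ X(-\alpha_0,z)=:\!\beta(z)\varepsilon_{\bar2}^*(z)\!:+:\!\varepsilon_{\bar1}^*(z)\varepsilon_2(z)\!:$ - $D_{n+1}$: $X(\alpha_0,z)=\sqrt2:\!\bar e(z)\beta^*(z)\!:$, $\ X(-\alpha_0,z)=\sqrt2:\!\beta(z)\bar e(z)\!:$ - $A_{2n}$: $X(\alpha_0,z)=:\!\varepsilon_{\bar1}(z)\beta^*(z)\!:$, $\ X(-\alpha_0,z)=:\!\beta(z)\varepsilon_{\bar1}^*(z)\!:$ - $D_4$: $X(\alpha_0,z)=:\!\varepsilon_{\bar1}(z)\beta^*(z)\!:+\omega:\!\varepsilon_{\bar1}^*(z)\varepsilon_1^*(z)\!:+\omega^2:\!\varepsilon_{\bar2}^*(z)\varepsilon_2^*(z)\!:$, $\ X(-\alpha_0,z)=:\!\beta(z)\varepsilon_{\bar1}^*(z)\!:+\omega^2:\!\varepsilon_1(z)\varepsilon_{\bar1}(z)\!:+\omega:\!\varepsilon_2(z)\varepsilon_{\bar2}(z)\!:$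 **$X(\pm\alpha_i,z)$, $1\le i\le n-1$:** - $A_{2n-1}$ and $A_{2n}$: $X(\alpha_i,z)=:\!\varepsilon_i(z)\varepsilon_{i+1}^*(z)\!:+:\!\varepsilon_{\bar i}^*(z)\varepsilon_{\overline{i+1}}(z)\!:$, $\ X(-\alpha_i,z)=:\!\varepsilon_{i+1}(z)\varepsilon_i^*(z)\!:+:\!\varepsilon_{\overline{i+1}}^*(z)\varepsilon_{\bar i}(z)\!:$ - $D_{n+1}$: $X(\alpha_i,z)=:\!\varepsilon_i(z)\varepsilon_{i+1}^*(z)\!:$, $\ X(-\alpha_i,z)=:\!\varepsilon_{i+1}(z)\varepsilon_i^*(z)\!:$ - $D_4$ ($i=1$): $X(\alpha_1,z)=:\!\varepsilon_1(z)\varepsilon_2^*(z)\!:+:\!\varepsilon_{\bar2}(z)\varepsilon_{\bar1}^*(z)\!:+:\!\varepsilon_{\bar2}(z)\varepsilon_{\bar1}(z)\!:$, $\ X(-\alpha_1,z)=:\!\varepsilon_2(z)\varepsilon_1^*(z)\!:+:\!\varepsilon_{\bar1}(z)\varepsilon_{\bar2}^*(z)\!:+:\!\varepsilon_{\bar1}^*(z)\varepsilon_{\bar2}^*(z)\!:$ **$X(\pm\alpha_n,z)$:** - $A_{2n-1}$: $X(\alpha_n,z)=:\!\varepsilon_n(z)\varepsilon_{\bar n}^*(z)\!:$, $\ X(-\alpha_n,z)=:\!\varepsilon_{\bar n}(z)\varepsilon_n^*(z)\!:$ - $D_{n+1}$: $X(\alpha_n,z)=\sqrt2:\!\varepsilon_n(z)e(z)\!:$,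 $\ X(-\alpha_n,z)=\sqrt2:\!e(z)\varepsilon_n^*(z)\!:$ - $A_{2n}$: $X(\alpha_n,z)=\sqrt2\,(:\!\varepsilon_n(z)\bar e(z)\!:+:\!\varepsilon_{\bar n}^*(z)e(z)\!:)$, $\ X(-\alpha_n,z)=\sqrt2\,(:\!e(z)\varepsilon_n^*(z)\!:+:\!\bar e(z)\varepsilon_{\bar n}(z)\!:)$ - $D_4$ ($n=2$): $X(\alpha_2,z)=:\!\varepsilon_2(z)\varepsilon_{\bar2}^*(z)\!:$, $\ X(-\alpha_2,z)=:\!\varepsilon_{\bar2}(z)\varepsilon_2^*(z)\!:$ **$\alpha_0(z)$:** - $A_{2n-1}$: $:\!\beta^*(z)\beta(z)\!:+:\!\varepsilon_2^*(z)\varepsilon_2(z)\!:+:\!\varepsilon_{\bar1}(z)\varepsilon_{\bar1}^*(z)\!:+:\!\varepsilon_{\bar2}(z)\varepsilon_{\bar2}^*(z)\!:$ - $D_{n+1}$: $2:\!\beta^*(z)\beta(z)\!:$ - $A_{2n}$: $:\!\varepsilon_{\bar1}(z)\varepsilon_{\bar1}^*(z)\!:+:\!\beta^*(z)\beta(z)\!:$ - $D_4$: $:\!\varepsilon_1^*(z)\varepsilon_1(z)\!:+:\!\beta^*(z)\beta(z)\!:+:\!\varepsilon_2^*(z)\varepsilon_2(z)\!:+:\!\varepsilon_{\bar2}^*(z)\varepsilon_{\bar2}(z)\!:$ **$\alpha_i(z)$, $1\le i\le n-1$:** - $A_{2n-1}$ and $A_{2n}$: $:\!\varepsilon_i(z)\varepsilon_i^*(z)\!:+:\!\varepsilon_{i+1}^*(z)\varepsilon_{i+1}(z)\!:+:\!\varepsilon_{\bar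 i}^*(z)\varepsilon_{\bar i}(z)\!:+:\!\varepsilon_{\overline{i+1}}(z)\varepsilon_{\overline{i+1}}^*(z)\!:$ - $D_{n+1}$: $:\!\varepsilon_i(z)\varepsilon_i^*(z)\!:+:\!\varepsilon_{i+1}^*(z)\varepsilon_{i+1}(z)\!:$ - $D_4$ ($i=1$): $:\!\varepsilon_1(z)\varepsilon_1^*(z)\!:+:\!\varepsilon_2^*(z)\varepsilon_2(z)\!:+2:\!\varepsilon_{\bar2}(z)\varepsilon_{\bar2}^*(z)\!:$ **$\alpha_n(z)$:** - $A_{2n-1}$: $:\!\varepsilon_n(z)\varepsilon_n^*(z)\!:+:\!\varepsilon_{\bar n}^*(z)\varepsilon_{\bar n}(z)\!:$ - $D_{n+1}$: $2:\!\varepsilon_n(z)\varepsilon_n^*(z)\!:$ - $A_{2n}$: $2\,(:\!\varepsilon_n(z)\varepsilon_n^*(z)\!:+:\!\varepsilon_{\bar n}^*(z)\varepsilon_{\bar n}(z)\!:)$ - $D_4$ ($n=2$): $:\!\varepsilon_2(z)\varepsilon_2^*(z)\!:+:\!\varepsilon_{\bar2}^*(z)\varepsilon_{\bar2}(z)\!:$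
   Context: All Lie algebras and vector spaces are over $\mathbb C$. The label ''$D_4$'' always refers to the triality case ($r=3$, $n=2$); ''$D_{n+1}$'' refers to the case $r=2$. **Cartan matrix.** $I=\{1,\dots,n\}$, $\tilde I=I\cup\{0\}$; $(a_{ij})_{i,j\in\tilde I}$ (the Cartan matrix of $A_{2n-1}^{(2)},D_{n+1}^{(2)},A_{2n}^{(2)},D_4^{(3)}$ respectively) has $a_{ii}=2$ and the following nonzero off-diagonal entries, all others being $0$: - $A_{2n-1}$: $a_{i,i+1}=a_{i+1,i}=-1$ for $1\le i\le n-2$; $a_{n-1,n}=-2$, $a_{n,n-1}=-1$; $a_{02}=a_{20}=-1$. - $D_{n+1}$: $a_{i,i+1}=a_{i+1,i}=-1$ for $1\le i\le n-2$; $a_{n-1,n}=-1$, $a_{n,n-1}=-2$; $a_{01}=-2$, $a_{10}=-1$. - $A_{2n}$: $a_{i,i+1}=a_{i+1,i}=-1$ for $1\le i\le n-2$; $a_{n-1,n}=-1$, $a_{n,n-1}=-2$; $a_{01}=-1$, $a_{10}=-2$. - $D_4$: $a_{12}=-3$, $a_{21}=-1$; $a_{01}=a_{10}=-1$. **The Lie algebra $t(\mathfrak g)$.** It is generated by symbols $\not{c}$, $\alpha_m(k)$, $X(\alpha_m,k)$, $X(-\alpha_m,k)$ ($m\in\tilde I$, $k\in\mathbb Z$), subject to: $\not{c}$ is central, and for all $k,l,k_1,k_2,\dots\in\mathbb Z$ (with the same choice of sign throughout each relation): 1. $[\alpha_0(k),\alpha_0(l)]=2rk\,\delta_{k,-l}\not{c}$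 for $A_{2n-1},D_{n+1},D_4$; $=2k\,\delta_{k,-l}\not{c}$ for $A_{2n}$. 2. For $j\in I$: $[\alpha_0(k),\alpha_j(l)]=ra_{0j}k\,\delta_{k,-l}\not{c}$ for $A_{2n-1},A_{2n},D_4$; $=a_{0j}k\,\delta_{k,-l}\not{c}$ for $D_{n+1}$. 3. For $i,j\in I$, $i\le j$, $(i,j)\ne(n-1,n),(n,n)$: $[\alpha_i(k),\alpha_j(l)]=ra_{ij}k\,\delta_{k,-l}\not{c}$ for $A_{2n-1},A_{2n},D_4$; $=a_{ij}k\,\delta_{k,-l}\not{c}$ for $D_{n+1}$. 4. $[\alpha_{n-1}(k),\alpha_n(l)]=\kappa\,a_{n-1,n}k\,\delta_{k,-l}\not{c}$ with $\kappa=1$ for $A_{2n-1},D_4$; $\kappa=4$ for $A_{2n}$; $\kappa=2$ for $D_{n+1}$. 5. $[\alpha_n(k),\alpha_n(l)]=\kappa' k\,\delta_{k,-l}\not{c}$ with $\kappa'=2$ for $A_{2n-1},D_4$; $\kappa'=8$ for $A_{2n}$; $\kappa'=4$ for $D_{n+1}$. 6. For $i,j\in\tilde I$: $[\alpha_i(k),X(\pm\alpha_j,l)]=\pm a_{ij}X(\pm\alpha_j,k+l)$. 7. For $i\in\tilde I$: $[X(\pm\alpha_i,k),X(\pm\alpha_i,l)]=0$. 8. For $i,j\in\tilde I$: $[X(\alpha_i,k),X(-\alpha_j,l)]=\delta_{i,j}\{\alpha_i(k+l)+\nu_i k\,\delta_{k,-l}\not{c}\}$, where $\nu_i=r-\delta_{i,n}(r-1)$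 for $A_{2n-1},D_4$; $\nu_i=r(1+\delta_{i,n}(r-1))-\delta_{i,0}(r-1)$ for $A_{2n}$; $\nu_i=1+(\delta_{i,0}+\delta_{i,n})(r-1)$ for $D_{n+1}$. 9. For $i\ne j$ in $\tilde I$, with $M=1-a_{ij}\in\{1,2,3,4\}$: $\operatorname{ad}X(\pm\alpha_i,k_{M+1})\cdots\operatorname{ad}X(\pm\alpha_i,k_2)\,X(\pm\alpha_j,k_1)=0$. Generating series: $\alpha_i(z)=\sum_{k\in\mathbb Z}\alpha_i(k)z^{-k-1}$, $X(\pm\alpha_i,z)=\sum_{k\in\mathbb Z}X(\pm\alpha_i,k)z^{-k-1}$. **Level.** A representation has level $(k_0,k_1)$ if the degree zero central elements $c_0=\overline{s^{-1}ds}$ and $c_1=\overline{t^{-1}dt}$ of the twisted toroidal Lie algebra act as the scalars $k_0,k_1$. In $t(\mathfrak g)$, $c_0$ is $\not{c}$, and $c_1$ is (up to a nonzero scalar) the central element $\alpha_0(0)+\alpha_1(0)+2\sum_{i=2}^{n}\alpha_i(0)$ for $A_{2n-1}$; $\alpha_0(0)+2\sum_{i=1}^{n-1}\alpha_i(0)+\alpha_n(0)$ for $D_{n+1}$; $\sum_{i=0}^{n-1}\alpha_i(0)+\tfrac12\alpha_n(0)$ for $A_{2n}$; $\alpha_0(0)+2\alpha_1(0)+3\alpha_2(0)$ for $D_4$. So level $(1,0)$ means that $\not{c}$ acts as $1$ and this element acts as $0$. **Clifford algebra.** Let $P_{\mathbb C}$ be the vector space with basis $c,\varepsilon_1,\dots,\varepsilon_n,\varepsilon_{\bar1},\dots,\varepsilon_{\bar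 n}$ and symmetric bilinear form $(\varepsilon_i|\varepsilon_j)=(\varepsilon_{\bar i}|\varepsilon_{\bar j})=\delta_{ij}$, $(\varepsilon_i|\varepsilon_{\bar j})=0$, $(c|c)=(c|\varepsilon_i)=(c|\varepsilon_{\bar i})=0$. Let $P_{\mathbb C}^*=\{a^*:a\in P_{\mathbb C}\}$ be a second copy ($a\mapsto a^*$ linear). Set $\beta=-\sqrt2\,c+\varepsilon_1$ ($A_{2n-1}$), $\beta=-c+\varepsilon_1$ ($D_{n+1}$), $\beta=-\tfrac1{\sqrt2}c+\varepsilon_1$ ($A_{2n}$), $\beta=-\sqrt3\,c+\varepsilon_1$ ($D_4$). The Clifford algebra is generated by a central element $\mathbf 1$ and modes $a(k),a^*(k)$ ($a\in P_{\mathbb C}$, $k\in\mathbb Z+\frac12$, linear in $a$) with $\{a(k),b(l)\}=\{a^*(k),b^*(l)\}=0$, $\{a(k),b^*(l)\}=(a|b)\delta_{k,-l}\mathbf 1$. In type $D_{n+1}$ (resp. $A_{2n}$) one adjoins two ghost fields $e,\bar e$ with modes $e(k),\bar e(k)$, $k\in\mathbb Z+\frac12$, anticommuting with all $a(l),a^*(l)$ and satisfying $\{x(k),y(l)\}=\langle x,y\rangle\delta_{k,-l}\mathbf 1$ for $x,y\in\{e,\bar e\}$, where the only nonzero values are $\langle e,e\rangle=\langle\bar e,\bar e\rangle=1$ (resp. $\langle e,\bar e\rangle=\langle\bar e,e\rangle=1$). **Fock space.** $V=\bigotimes_a\big(\bigotimes_{k\in\mathbb Z_{\ge0}+1/2}\mathbb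 C[a(-k)]\otimes\bigotimes_{k\in\mathbb Z_{\ge0}+1/2}\mathbb C[a^*(-k)]\big)$, $a$ ranging over the basis $c,\varepsilon_1,\dots,\varepsilon_n,\varepsilon_{\bar1},\dots,\varepsilon_{\bar n}$ of $P_{\mathbb C}$, understood as the fermionic Fock space: it is generated from a vacuum vector by the anticommuting creation operators, where modes of index $-k<0$ act as creation operators, modes of index $k>0$ as annihilation operators (killing the vacuum), and $\mathbf 1$ acts as the identity. In types $D_{n+1}$ and $A_{2n}$, $V$ also includes the creation modes of the ghost fields $e,\bar e$. **Fields and normal ordering.** For each symbol $a$ (from $P_{\mathbb C}$, $P_{\mathbb C}^*$ or a ghost), $a(z)=\sum_{k\in\mathbb Z+1/2}a(k)z^{-k-1/2}$. The normal ordered product $:\!a(z)b(z)\!:$ is bilinear in $a$ and $b$ and is defined on modes by $:\!a(m)b(l)\!:=a(m)b(l)$ if $m<0$ and $=-b(l)a(m)$ if $m>0$; it satisfies $:\!a(z)b(w)\!:=-:\!b(w)a(z)\!:$. Convention: since $c$ is orthogonal to everything (its modes are ''central''), normal ordered products with a factor $c$ or $c^*$ are set equal to $0$, so for example $:\!\varepsilon_{\bar1}(z)\beta^*(z)\!:=:\!\varepsilon_{\bar1}(z)\varepsilon_1^*(z)\!:$. *)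

(* Defs.v *)
From HB Require Import structures.
From mathcomp Require Import all_boot all_order all_algebra.
From mathcomp Require Import finmap generic_quotient.
From mathcomp Require Import boolp classical_sets functions cardinality fsbigop.
From mathcomp Require Import reals trigo complex ring zify.
From mathcomp.multinomials Require Import monalg.

Set Implicit Arguments.
Unset Strict Implicit.
Unset Printing Implicit Defensive.

Import Order.TTheory GRing.Theory Num.Theory.

Local Open Scope ring_scope.
Local Open Scope quotient_scope.

HB.mixin Record Lmodule_isLieAlgebra (K : fieldType) L of GRing.Lmodule K L := {
  lie : L -> L -> L;
  lie_linearl : forall y : L, linear (fun x : L => lie x y);
  lie_linearr : forall x : L, linear (lie x);
  liexx : forall x : L, lie x x = 0;
  lie_jacobi : forall x y z : L,
    lie x (lie y z) + lie y (lie z x) + lie z (lie x y) = 0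
}.

#[short(type="lieAlgType")]
HB.structure Definition LieAlgebra (K : fieldType) :=
  { L of GRing.Lmodule K L & Lmodule_isLieAlgebra K L }.

Definition is_lie_rep (K : fieldType) (L : lieAlgType K) (V : lmodType K)
    (rho : L -> V -> V) : Prop :=
  [/\ forall x : L, linear (rho x),
      forall v : V, linear (fun x : L => rho x v) &
      forall (x y : L) (v : V),
        rho (lie x y) v = rho x (rho y v) - rho y (rho x v)].

Inductive lie_term (K : fieldType) (X : Type) : Type :=
  | LGen of X
  | LZero
  | LAdd of lie_term K X & lie_term K X
  | LScale of K & lie_term K X
  | LBr of lie_term K X & lie_term K X.

Arguments LGen {K X}.
Arguments LZero {K X}.

HB.instance Definition _ (K : fieldType) (X : Type) :=
  gen_eqMixin (lie_term K X).
HB.instance Definition _ (K : fieldType) (X : Type) :=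
  gen_choiceMixin (lie_term K X).

Inductive lie_cong (K : fieldType) (X : Type)
    (rel : lie_term K X -> lie_term K X -> Prop) :
    lie_term K X -> lie_term K X -> Prop :=
  | LC_rel x y of rel x y : lie_cong rel x y
  | LC_refl x : lie_cong rel x x
  | LC_sym x y of lie_cong rel x y : lie_cong rel y x
  | LC_trans x y z of lie_cong rel x y & lie_cong rel y z : lie_cong rel x z
  | LC_add x x' y y' of lie_cong rel x x' & lie_cong rel y y' :
      lie_cong rel (LAdd x y) (LAdd x' y')
  | LC_scale a x x' of lie_cong rel x x' :
      lie_cong rel (LScale a x) (LScale a x')
  | LC_br x x' y y' of lie_cong rel x x' & lie_cong rel y y' :
      lie_cong rel (LBr x y) (LBr x' y')
  | LC_addA x y z : lie_cong rel (LAdd x (LAdd y z)) (LAdd (LAdd x y) z)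
  | LC_addC x y : lie_cong rel (LAdd x y) (LAdd y x)
  | LC_add0 x : lie_cong rel (LAdd LZero x) x
  | LC_addN x : lie_cong rel (LAdd (LScale (-1) x) x) LZero
  | LC_scaleA a b x : lie_cong rel (LScale a (LScale b x)) (LScale (a * b) x)
  | LC_scale1 x : lie_cong rel (LScale 1 x) x
  | LC_scaleDr a x y :
      lie_cong rel (LScale a (LAdd x y)) (LAdd (LScale a x) (LScale a y))
  | LC_scaleDl a b x :
      lie_cong rel (LScale (a + b) x) (LAdd (LScale a x) (LScale b x))
  | LC_brDl x y z : lie_cong rel (LBr (LAdd x y) z) (LAdd (LBr x z) (LBr y z))
  | LC_brDr x y z : lie_cong rel (LBr x (LAdd y z)) (LAdd (LBr x y) (LBr x z))
  | LC_brZl a x y : lie_cong rel (LBr (LScale a x) y) (LScale a (LBr x y))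
  | LC_brZr a x y : lie_cong rel (LBr x (LScale a y)) (LScale a (LBr x y))
  | LC_brxx x : lie_cong rel (LBr x x) LZero
  | LC_jacobi x y z :
      lie_cong rel
        (LAdd (LAdd (LBr x (LBr y z)) (LBr y (LBr z x))) (LBr z (LBr x y)))
        LZero.

Section PresentedLieAlgebra.
Context {K : fieldType} {X : Type} (rel : lie_term K X -> lie_term K X -> Prop).

Definition lie_congb (x y : lie_term K X) : bool := `[< lie_cong rel x y >].

Lemma lie_congb_refl : reflexive lie_congb.
Proof. by move=> x; apply/asboolP; exact: LC_refl. Qed.

Lemma lie_congb_sym : symmetric lie_congb.
Proof. by move=> x y; apply/asboolP/asboolP; exact: LC_sym. Qed.

Lemma lie_congb_trans : transitive lie_congb.
Proof.
move=> y x z /asboolP xy /asboolP yz; apply/asboolP; exact: LC_trans xy yz.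
Qed.

Canonical lie_equiv := EquivRel lie_congb lie_congb_refl lie_congb_sym
  lie_congb_trans.

Definition presented_lie : Type := {eq_quot lie_equiv}.
HB.instance Definition _ := Choice.on presented_lie.

Definition lie_class (x : lie_term K X) : presented_lie := \pi_{eq_quot lie_equiv} x.
Definition lie_repr (u : presented_lie) : lie_term K X :=
  repr (u : {eq_quot lie_equiv}).

Lemma lie_reprK (u : presented_lie) : lie_class (lie_repr u) = u.
Proof. exact: reprK. Qed.

Lemma lie_classP (x y : lie_term K X) :
  lie_cong rel x y <-> lie_class x = lie_class y.
Proof.
split=> [xy|/eqmodP /asboolP //].
by apply/eqmodP/asboolP.
Qed.

Lemma lie_repr_class (x : lie_term K X) : lie_cong rel (lie_repr (lie_class x)) x.
Proof. by apply/lie_classP; rewrite lie_reprK. Qed.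

Definition pl_zero : presented_lie := lie_class LZero.
Definition pl_add (u v : presented_lie) : presented_lie :=
  lie_class (LAdd (lie_repr u) (lie_repr v)).
Definition pl_scale (a : K) (u : presented_lie) : presented_lie :=
  lie_class (LScale a (lie_repr u)).
Definition pl_opp (u : presented_lie) : presented_lie := pl_scale (-1) u.
Definition pl_br (u v : presented_lie) : presented_lie :=
  lie_class (LBr (lie_repr u) (lie_repr v)).

Lemma pl_addE x y : pl_add (lie_class x) (lie_class y) = lie_class (LAdd x y).
Proof. by apply/lie_classP; apply: LC_add; exact: lie_repr_class. Qed.

Lemma pl_scaleE a x : pl_scale a (lie_class x) = lie_class (LScale a x).
Proof. by apply/lie_classP; apply: LC_scale; exact: lie_repr_class. Qed.

Lemma pl_brE x y : pl_br (lie_class x) (lie_class y) = lie_class (LBr x y).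
Proof. by apply/lie_classP; apply: LC_br; exact: lie_repr_class. Qed.

Let plE := (pl_addE, pl_scaleE, pl_brE).

Lemma pl_ind (P : presented_lie -> Prop) :
  (forall x, P (lie_class x)) -> forall u, P u.
Proof. by move=> h u; rewrite -[u]lie_reprK. Qed.

Lemma pl_addA : associative pl_add.
Proof.
elim/pl_ind=> x; elim/pl_ind=> y; elim/pl_ind=> z; rewrite !plE.
by apply/lie_classP; exact: LC_addA.
Qed.

Lemma pl_addC : commutative pl_add.
Proof.
elim/pl_ind=> x; elim/pl_ind=> y; rewrite !plE.
by apply/lie_classP; exact: LC_addC.
Qed.

Lemma pl_add0 : left_id pl_zero pl_add.
Proof.
by elim/pl_ind=> x; rewrite !plE; apply/lie_classP; exact: LC_add0.
Qed.

Lemma pl_addN : left_inverse pl_zero pl_opp pl_add.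
Proof.
by elim/pl_ind=> x; rewrite /pl_opp !plE; apply/lie_classP; exact: LC_addN.
Qed.

HB.instance Definition _ :=
  GRing.isZmodule.Build presented_lie pl_addA pl_addC pl_add0 pl_addN.

Lemma pl_scaleA a b u : pl_scale a (pl_scale b u) = pl_scale (a * b) u.
Proof.
by elim/pl_ind: u => x; rewrite !plE; apply/lie_classP; exact: LC_scaleA.
Qed.

Lemma pl_scale1 : left_id 1 pl_scale.
Proof.
by elim/pl_ind=> x; rewrite !plE; apply/lie_classP; exact: LC_scale1.
Qed.

Lemma pl_scaleDr : right_distributive pl_scale +%R.
Proof.
move=> a; elim/pl_ind=> x; elim/pl_ind=> y.
rewrite /GRing.add /= !plE; apply/lie_classP; exact: LC_scaleDr.
Qed.

Lemma pl_scaleDl u : {morph pl_scale^~ u : a b / a + b}.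
Proof.
move=> a b; elim/pl_ind: u => x.
rewrite [in RHS]/GRing.add /= !plE; apply/lie_classP; exact: LC_scaleDl.
Qed.

HB.instance Definition _ := GRing.Zmodule_isLmodule.Build K presented_lie
  pl_scaleA pl_scale1 pl_scaleDr pl_scaleDl.

Lemma pl_DE x y : lie_class x + lie_class y = lie_class (LAdd x y).
Proof. exact: pl_addE. Qed.

Lemma pl_ZE a x : a *: lie_class x = lie_class (LScale a x).
Proof. exact: pl_scaleE. Qed.

Lemma pl_0E : lie_class LZero = 0. Proof. by []. Qed.

Lemma pl_br_linearl v : linear (fun u => pl_br u v).
Proof.
move=> a u w; elim/pl_ind: u => x; elim/pl_ind: w => y; elim/pl_ind: v => z.
rewrite pl_ZE pl_DE !pl_brE pl_ZE pl_DE; apply/lie_classP.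
apply: LC_trans (LC_brDl _ _ _ _) _.
by apply: LC_add; [exact: LC_brZl|exact: LC_refl].
Qed.

Lemma pl_br_linearr v : linear (pl_br v).
Proof.
move=> a u w; elim/pl_ind: u => x; elim/pl_ind: w => y; elim/pl_ind: v => z.
rewrite pl_ZE pl_DE !pl_brE pl_ZE pl_DE; apply/lie_classP.
apply: LC_trans (LC_brDr _ _ _ _) _.
by apply: LC_add; [exact: LC_brZr|exact: LC_refl].
Qed.

Lemma pl_brxx u : pl_br u u = 0.
Proof.
by elim/pl_ind: u => x; rewrite pl_brE -pl_0E; apply/lie_classP; exact: LC_brxx.
Qed.

Lemma pl_jacobi u v w :
  pl_br u (pl_br v w) + pl_br v (pl_br w u) + pl_br w (pl_br u v) = 0.
Proof.
elim/pl_ind: u => x; elim/pl_ind: v => y; elim/pl_ind: w => z.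
by rewrite !pl_brE !pl_DE -pl_0E; apply/lie_classP; exact: LC_jacobi.
Qed.

HB.instance Definition _ := Lmodule_isLieAlgebra.Build K presented_lie
  pl_br_linearl pl_br_linearr pl_brxx pl_jacobi.

Definition pl_gen (x : X) : presented_lie := lie_class (LGen x).

End PresentedLieAlgebra.

Arguments presented_lie {K X} rel.
Arguments pl_gen {K X} rel x.

(* A_(2n-1), D_(n+1), A_(2n) with r = 2, and D_4 with r = 3; the Cartan matrices
   are those of A_(2n-1)^(2), D_(n+1)^(2), A_(2n)^(2), D_4^(3). *)
Variant ttype := A2nm1 | Dnp1 | A2n | D4.

Definition admissible (ty : ttype) (n : nat) : bool :=
  match ty with
  | A2nm1 => (3 <= n)%N
  | Dnp1 | A2n => (2 <= n)%N
  | D4 => n == 2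
  end.

Definition tw_order (ty : ttype) : int := if ty is D4 then 3 else 2.

(* j is the successor of i in the chain 1 - 2 - ... - (n-1) *)
Definition chain (n i j : nat) : bool :=
  [&& (0 < i)%N, (i.+2 <= n)%N & j == i.+1].

Definition cartan (ty : ttype) (n i j : nat) : int :=
  if i == j then 2 else
  match ty with
  | A2nm1 =>
      if [|| chain n i j, chain n j i, (i, j) == (0, 2)%N | (i, j) == (2, 0)%N]
      then -1
      else if (i, j) == (n.-1, n) then -2
      else if (i, j) == (n, n.-1) then -1
      else 0
  | Dnp1 =>
      if chain n i j || chain n j i then -1
      else if (i, j) == (n.-1, n) then -1
      else if (i, j) == (n, n.-1) then -2
      else if (i, j) == (0, 1)%N then -2
      else if (i, j) == (1, 0)%N then -1
      else 0
  | A2n =>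
      if chain n i j || chain n j i then -1
      else if (i, j) == (n.-1, n) then -1
      else if (i, j) == (n, n.-1) then -2
      else if (i, j) == (0, 1)%N then -1
      else if (i, j) == (1, 0)%N then -2
      else 0
  | D4 =>
      if (i, j) == (1, 2)%N then -3
      else if (i, j) == (2, 1)%N then -1
      else if (i, j) == (0, 1)%N then -1
      else if (i, j) == (1, 0)%N then -1
      else 0
  end.

(* In GX the boolean is the sign: GX true i k is X(alpha_i, k) and
   GX false i k is X(-alpha_i, k). *)
Variant t_gen (n : nat) :=
  | Gc
  | Galpha of 'I_n.+1 & int
  | GX of bool & 'I_n.+1 & int.

Arguments Gc {n}.

Definition pm (s : bool) : int := if s then 1 else -1.

Definition nu (ty : ttype) (n i : nat) : int :=
  let r := tw_order ty in
  let d (j : nat) : int := (i == j)%:Z in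
  match ty with
  | A2nm1 | D4 => r - d n * (r - 1)
  | A2n => r * (1 + d n * (r - 1)) - d 0%N * (r - 1)
  | Dnp1 => 1 + (d 0%N + d n) * (r - 1)
  end.

Definition kappa (ty : ttype) : int :=
  match ty with A2nm1 | D4 => 1 | A2n => 4 | Dnp1 => 2 end.

Definition kappa' (ty : ttype) : int :=
  match ty with A2nm1 | D4 => 2 | A2n => 8 | Dnp1 => 4 end.

Section ToroidalRelations.
Context (K : fieldType) (ty : ttype) (n : nat).

Local Notation term := (lie_term K (t_gen n)).
Local Notation c := (LGen Gc : term).
Local Notation al i k := (LGen (Galpha i k) : term).
Local Notation X s i k := (LGen (GX s i k) : term).
Local Notation a i j := (cartan ty n i j).
Local Notation r := (tw_order ty).
Local Notation "z '**' t" := (LScale (z%:~R : K) t) (at level 40).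

Definition delta (k l : int) : int := (k == - l)%:Z.

Inductive t_rel : term -> term -> Prop :=
  | t_rel0 x : t_rel (LBr c x) LZero
  | t_rel1 (k l : int) :
      t_rel (LBr (al ord0 k) (al ord0 l))
            (((if ty is A2n then 2 else 2 * r) * k * delta k l) ** c)
  | t_rel2 (j : 'I_n.+1) (k l : int) of (0 < j)%N :
      t_rel (LBr (al ord0 k) (al j l))
            (((if ty is Dnp1 then 1 else r) * a 0%N j * k * delta k l) ** c)
  | t_rel3 (i j : 'I_n.+1) (k l : int) of (0 < i)%N & (i <= j)%N
      & (val i, val j) != (n.-1, n) & (val i, val j) != (n, n) :
      t_rel (LBr (al i k) (al j l))
            (((if ty is Dnp1 then 1 else r) * a i j * k * delta k l) ** c)
  | t_rel4 (i : 'I_n.+1) (k l : int) of i = n.-1 :> nat :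
      t_rel (LBr (al i k) (al ord_max l))
            ((kappa ty * a n.-1 n * k * delta k l) ** c)
  | t_rel5 (k l : int) :
      t_rel (LBr (al ord_max k) (al ord_max l))
            ((kappa' ty * k * delta k l) ** c)
  | t_rel6 s (i j : 'I_n.+1) (k l : int) :
      t_rel (LBr (al i k) (X s j l)) ((pm s * a i j) ** X s j (k + l))
  | t_rel7 s (i : 'I_n.+1) (k l : int) :
      t_rel (LBr (X s i k) (X s i l)) LZero
  | t_rel8 (i j : 'I_n.+1) (k l : int) :
      t_rel (LBr (X true i k) (X false j l))
            ((i == j)%:Z ** LAdd (al i (k + l)) ((nu ty n i * k * delta k l) ** c))
  | t_rel9 s (i j : 'I_n.+1) (k1 : int) (ks : seq int)
      of i != j & (size ks)%:Z = 1 - a i j :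
      t_rel (foldl (fun t k => LBr (X s i k) t) (X s j k1) ks) LZero.

End ToroidalRelations.

Definition t_alg (R : realType) (ty : ttype) (n : nat) : lieAlgType R[i] :=
  presented_lie (@t_rel R[i] ty n).

Definition t_c (R : realType) (ty : ttype) (n : nat) : t_alg R ty n :=
  pl_gen (@t_rel R[i] ty n) Gc.
Definition t_alpha (R : realType) (ty : ttype) (n : nat) (i : 'I_n.+1) (k : int) :
  t_alg R ty n := pl_gen (@t_rel R[i] ty n) (Galpha i k).
Definition t_X (R : realType) (ty : ttype) (n : nat) (s : bool) (i : 'I_n.+1)
  (k : int) : t_alg R ty n := pl_gen (@t_rel R[i] ty n) (GX s i k).

(* the degree zero element c_1, up to a nonzero scalar *)
Definition t_c1 (R : realType) (ty : ttype) (n : nat) : t_alg R ty n :=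
  \sum_(i < n.+1)
    (match ty with
     | A2nm1 => if (i < 2)%N then 1 else 2
     | Dnp1 => if (i == 0 :> nat) || (i == n :> nat) then 1 else 2
     | A2n => if i == n :> nat then 2^-1 else 1
     | D4 => i.+1%:R
     end : R[i]) *: t_alpha R ty i 0.

(* Labels of the basis of P_C: None is c, Some (inl i) is eps_(i+1) and
   Some (inr i) is eps_(bar(i+1)), as 'I_n starts at 0. *)
Definition plabel (n : nat) : Type := option ('I_n + 'I_n).
HB.instance Definition _ n := Finite.on (plabel n).

Definition num_ghosts (ty : ttype) : nat :=
  match ty with Dnp1 | A2n => 2 | A2nm1 | D4 => 0 end.

(* Labels of the basis of the space of symbols P_C + P_C^* + ghosts, in this
   order; the ghosts are 0 for e and 1 for ebar. *)
Definition symbol (ty : ttype) (n : nat) : Type :=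
  (plabel n + plabel n + 'I_(num_ghosts ty))%type.
HB.instance Definition _ ty n := Finite.on (symbol ty n).

Definition pform (n : nat) (a b : plabel n) : bool :=
  (a != None) && (a == b).

Definition ghost_form (ty : ttype) (x y : 'I_(num_ghosts ty)) : bool :=
  match ty with
  | Dnp1 => x == y :> nat
  | A2n => x != y :> nat
  | A2nm1 | D4 => false
  end.

(* the coefficient of 1 in {x(k), y(-k)} *)
Definition sform (ty : ttype) (n : nat) (x y : symbol ty n) : bool :=
  match x, y with
  | inl (inl a), inl (inr b) | inl (inr a), inl (inl b) => pform a b
  | inr g, inr h => ghost_form g h
  | _, _ => false
  end.

Definition is_c (ty : ttype) (n : nat) (x : symbol ty n) : bool :=
  match x with inl (inl a) | inl (inr a) => a == None | inr _ => false end.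

(* (x, p) stands for the creation operator x(-(p + 1/2)). *)
Definition creator (ty : ttype) (n : nat) : Type := (symbol ty n * nat)%type.
HB.instance Definition _ ty n := Countable.on (creator ty n).

(* The exterior algebra on the creation operators: the basis vector << S >> is
   the product of the elements of the finite set S, in the order of increasing
   pickle from left to right, applied to the vacuum. *)
Definition fock (R : realType) (ty : ttype) (n : nat) : lmodType R[i] :=
  {malg R[i][{fset creator ty n}]}.

Definition fbasis (R : realType) (ty : ttype) (n : nat)
    (S : {fset creator ty n}) : fock R ty n :=
  (<< S >> : {malg R[i][{fset creator ty n}]}).

Definition koszul (R : realType) (ty : ttype) (n : nat) (x : creator ty n)
    (S : {fset creator ty n}) : R[i] :=
  (-1) ^+ count (fun y => (choice.pickle y < choice.pickle x)%N) S.

(* These two are locked only because their unfolding makes unification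
   diverge. *)
HB.lock Definition create1 (R : realType) (ty : ttype) (n : nat)
    (x : creator ty n) (S : {fset creator ty n}) : fock R ty n :=
  if x \in S then 0 else koszul R x S *: fbasis R (x |` S)%fset.

HB.lock Definition annihilate1 (R : realType) (ty : ttype) (n : nat)
    (x : creator ty n) (S : {fset creator ty n}) : fock R ty n :=
  if x \in S then koszul R x S *: fbasis R (S `\ x)%fset else 0.

Notation svect R ty n := {ffun symbol ty n -> R[i]}.
Notation pvect R n := {ffun plabel n -> R[i]}.

Section FockSpace.
Context {R : realType} {ty : ttype} {n : nat}.

Local Notation C := R[i].
Local Notation V := (fock R ty n).
Local Notation cr := (creator ty n).

(* linear extension of a map on basis vectors *)
Definition lext (f : {fset cr} -> V) (v : V) : V :=
  \sum_(S <- msupp (v : {malg C[{fset cr}]})) (v : {malg C[{fset cr}]})@_S *: f S.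

Definition vacuum : V := fbasis R fset0.

Definition create (x : cr) : V -> V := lext (create1 R x).

Definition annihilate (x : cr) : V -> V := lext (annihilate1 R x).

(* Half-integer modes are numbered by integers: smode x j is x(j + 1/2), the
   coefficient of z^(-j-1) in x(z). *)
Definition smode (x : symbol ty n) (j : int) (v : V) : V :=
  match j with
  | Negz p => create (x, p) v
  | Posz p => \sum_(y : symbol ty n | sform x y) annihilate (y, p) v
  end.

(* A field A is given by its modes: A(z) = sum_k A(k) z^(-k-1). *)
Definition field : lmodType C := int -> V -> V.

(* :x(i + 1/2) y(j + 1/2): for basis symbols x and y; by convention it is 0 if x
   or y is c or c^*. *)
Definition snop (x y : symbol ty n) (i j : int) (v : V) : V :=
  if is_c x || is_c y then 0
  else if i < 0 then smode x i (smode y j v)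
  else - smode y j (smode x i v).

Definition nop_mode (a b : svect R ty n) (i j : int) (v : V) : V :=
  \sum_x \sum_y
    (a x * b y) *: snop x y i j v.

(* :a(z) b(z): ; the modes of indices i + 1/2 and j + 1/2 contribute to
   z^(-k-1) when i + j + 1 = k.  On a given vector only finitely many terms are
   nonzero, see nop_finite below. *)
Definition nop (a b : svect R ty n) : field :=
  fun k v => \sum_(i \in [set: int]%classic) nop_mode a b i (k - 1 - i) v.

Definition vec (a : pvect R n) : svect R ty n :=
  [ffun x : symbol ty n =>
     if x is inl (inl p) then a p else 0 : C].
Definition star (a : pvect R n) : svect R ty n :=
  [ffun x : symbol ty n =>
     if x is inl (inr p) then a p else 0 : C].

(* eps i and epsb i are meant for 1 <= i <= n, and are 0 for other i. *)
Definition cc : pvect R n := [ffun p : plabel n => (p == None)%:R].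
Definition eps (i : nat) : pvect R n :=
  [ffun p : plabel n => if p is Some (inl j) then (j.+1 == i)%:R : C else 0 : C].
Definition epsb (i : nat) : pvect R n :=
  [ffun p : plabel n => if p is Some (inr j) then (j.+1 == i)%:R : C else 0 : C].

Definition ghost (g : nat) : svect R ty n :=
  [ffun x : symbol ty n => if x is inr h then (h == g :> nat)%:R : C else 0 : C].

End FockSpace.

Arguments field R ty n : clear implicits.

Section CliffordRelations.
Context {R : realType} {ty : ttype} {n : nat}.

Local Notation C := R[i].
Local Notation V := (fock R ty n).
Local Notation cr := (creator ty n).
Implicit Types (x y : cr) (S D : {fset cr}) (v : V).

Lemma lextE (f : {fset cr} -> V) (v : {malg C[{fset cr}]}) (D : {fset {fset cr}}) :
  (msupp v `<=` D)%fset -> lext f v = \sum_(S <- D) v@_S *: f S.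
Proof.
move=> vD; rewrite /lext; apply: big_fset_incl => // S _ vS.
by rewrite mcoeff_outdom ?scale0r.
Qed.

Lemma lext_linear (f : {fset cr} -> V) : linear (lext f).
Proof.
move=> a u v; pose D := (msupp u `|` msupp v)%fset.
have uD : (msupp u `<=` D)%fset by exact: fsubsetUl.
have vD : (msupp v `<=` D)%fset by exact: fsubsetUr.
rewrite (lextE f uD) (lextE f vD) (@lextE f _ D).
  rewrite scaler_sumr -big_split /=; apply: eq_bigr => S _.
  by rewrite mcoeffD mcoeffZ scalerDl scalerA.
apply: fsubset_trans (msuppD_le _ _) _; apply: fsetSU; exact: msuppZ_le.
Qed.

HB.instance Definition _ f :=
  GRing.isLinear.Build C V V *:%R (@lext R ty n f) (lext_linear f).

Lemma lext_basis (f : {fset cr} -> V) S : lext f (fbasis R S) = f S.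
Proof.
rewrite /lext msuppU oner_eq0 big_seq_fset1.
by rewrite mcoeffUU scale1r.
Qed.

Lemma lext0 (f : {fset cr} -> V) : lext f 0 = 0.
Proof. exact: linear0. Qed.

Lemma lextZ (f : {fset cr} -> V) a S : lext f (a *: fbasis R S) = a *: f S.
Proof. by rewrite linearZ /= lext_basis. Qed.

Lemma lextC (f g h k : {fset cr} -> V) (a : C) v :
  (forall S, lext f (g S) + lext h (k S) = a *: fbasis R S) ->
  lext f (lext g v) + lext h (lext k v) = a *: v.
Proof.
move=> H.
have [D [w ->]] : exists (D : {fset {fset cr}}) (w : {fset cr} -> C),
    v = \sum_(S <- D) w S *: fbasis R S.
  exists (msupp (v : {malg _[_]})), (fun S => (v : {malg _[_]})@_S).
  rewrite {1}(monalgE v); apply: eq_bigr => S _.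
  by apply/malgP => T; rewrite mcoeffZ !mcoeffU mulrnAr mulr1.
rewrite [lext g _]linear_sum [lext k _]linear_sum [lext f _]linear_sum.
rewrite [lext h _]linear_sum scaler_sumr -big_split /=; apply: eq_bigr => S _.
rewrite !linearZ /= !lext_basis !linearZ /= -scalerDr H.
by rewrite !scalerA mulrC.
Qed.

Lemma koszulU1 x y S : y \notin S ->
  koszul R x (y |` S)%fset
  = (-1) ^+ (choice.pickle y < choice.pickle x)%N * koszul R x S :> C.
Proof.
move=> yS; rewrite /koszul -exprD; congr (_ ^+ _).
by rewrite -!sum1_count big_mkcond [in RHS]big_mkcond big_fsetU1.
Qed.

Lemma koszulD1 x y S : y \in S ->
  koszul R x (S `\ y)%fset
  = (-1) ^+ (choice.pickle y < choice.pickle x)%N * koszul R x S :> C.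
Proof.
move=> yS; rewrite -{2}(fsetD1K yS) koszulU1 ?fsetD11//.
by rewrite mulrA -exprD addnn -mul2n exprM sqrrN expr1n expr1n mul1r.
Qed.

Lemma koszul_swap x y : x != y ->
  (-1) ^+ (choice.pickle y < choice.pickle x)%N
  = - (-1) ^+ (choice.pickle x < choice.pickle y)%N :> C.
Proof.
move=> xy; case: ltngtP => [_|_|e]; rewrite ?expr0 ?expr1 ?opprK//.
by case/eqP: xy; apply: (pcan_inj choice.pickleK); rewrite e.
Qed.

Lemma koszul_sqr x S : koszul R x S * koszul R x S = 1 :> C.
Proof. by rewrite /koszul -expr2 -exprM mulnC exprM sqrrN expr1n expr1n. Qed.

Lemma create1_in x S : x \in S -> create1 R x S = 0.
Proof. by rewrite create1.unlock => ->. Qed.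

Lemma create1_out x S :
  x \notin S -> create1 R x S = koszul R x S *: fbasis R (x |` S)%fset.
Proof. by rewrite create1.unlock => /negbTE ->. Qed.

Lemma annihilate1_in x S :
  x \in S -> annihilate1 R x S = koszul R x S *: fbasis R (S `\ x)%fset.
Proof. by rewrite annihilate1.unlock => ->. Qed.

Lemma annihilate1_out x S : x \notin S -> annihilate1 R x S = 0.
Proof. by rewrite annihilate1.unlock => /negbTE ->. Qed.

Lemma create_create x y v : create x (create y v) + create y (create x v) = 0.
Proof.
rewrite /create (@lextC _ _ _ _ 0) ?scale0r// => S; rewrite scale0r.
have [->|xy] := eqVneq x y.
  have [yS|yS] := boolP (y \in S); first by rewrite create1_in// lext0 addr0.
  by rewrite create1_out// lextZ create1_in ?fset1U1// scaler0 addr0.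
have yx : y != x by rewrite eq_sym.
have [yS|yS] := boolP (y \in S); have [xS|xS] := boolP (x \in S).
- by rewrite !create1_in// !lext0 addr0.
- rewrite [create1 _ y _]create1_in// [create1 _ x _]create1_out// lext0 lextZ.
  by rewrite create1_in ?scaler0 ?addr0// !inE yS orbT.
- rewrite [create1 _ x _]create1_in// [create1 _ y _]create1_out// lext0 lextZ.
  by rewrite create1_in ?scaler0 ?addr0// !inE xS orbT.
rewrite [create1 _ x S]create1_out// [create1 _ y S]create1_out// !lextZ.
rewrite !create1_out ?inE ?negb_or ?xy ?yx//.
rewrite !scalerA !koszulU1// (koszul_swap xy) fsetUCA -scalerDl.
by rewrite [X in X *: _](_ : _ = 0) ?scale0r//; ring.
Qed.

Lemma annihilate_annihilate x y v :
  annihilate x (annihilate y v) + annihilate y (annihilate x v) = 0.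
Proof.
rewrite /annihilate (@lextC _ _ _ _ 0) ?scale0r// => S; rewrite scale0r.
have [->|xy] := eqVneq x y.
  have [yS|yS] := boolP (y \in S); last by rewrite annihilate1_out// lext0 addr0.
  rewrite annihilate1_in// lextZ annihilate1_out ?scaler0 ?addr0//.
  by rewrite fsetD11.
have yx : y != x by rewrite eq_sym.
have [yS|yS] := boolP (y \in S); have [xS|xS] := boolP (x \in S).
- rewrite [annihilate1 _ x S]annihilate1_in// [annihilate1 _ y S]annihilate1_in//.
  rewrite !lextZ !annihilate1_in ?inE ?xy ?yx//.
  rewrite !scalerA !koszulD1// (koszul_swap xy) fsetDDl fsetUC -fsetDDl.
  by rewrite -scalerDl [X in X *: _](_ : _ = 0) ?scale0r//; ring.
- rewrite [annihilate1 _ x _]annihilate1_out// [annihilate1 _ y _]annihilate1_in//.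
  by rewrite lext0 lextZ annihilate1_out ?scaler0 ?addr0// !inE (negbTE xS) andbF.
- rewrite [annihilate1 _ y _]annihilate1_out// [annihilate1 _ x _]annihilate1_in//.
  by rewrite lext0 lextZ annihilate1_out ?scaler0 ?addr0// !inE (negbTE yS) andbF.
- by rewrite !annihilate1_out// !lext0 addr0.
Qed.

Lemma annihilate_create x y v :
  annihilate x (create y v) + create y (annihilate x v) = (x == y)%:R *: v.
Proof.
rewrite /annihilate /create; apply: lextC => S.
have [<-|xy] := eqVneq x y.
  rewrite scale1r; have [xS|xS] := boolP (x \in S).
    rewrite create1_in// annihilate1_in// lext0 add0r lextZ.
    rewrite create1_out ?fsetD11// scalerA koszulD1// ltnn mul1r.
    by rewrite koszul_sqr scale1r fsetD1K.
  rewrite create1_out// [annihilate1 _ x S]annihilate1_out// lext0 addr0 lextZ.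
  rewrite annihilate1_in ?fset1U1// scalerA koszulU1// ltnn mul1r.
  by rewrite koszul_sqr scale1r fsetU1K.
have yx : y != x by rewrite eq_sym.
rewrite scale0r.
have [yS|yS] := boolP (y \in S); have [xS|xS] := boolP (x \in S).
- rewrite create1_in// annihilate1_in// lext0 lextZ create1_in ?scaler0 ?addr0//.
  by rewrite !inE yS yx.
- by rewrite create1_in// annihilate1_out// !lext0 addr0.
- rewrite [create1 _ y S]create1_out// [annihilate1 _ x S]annihilate1_in// !lextZ.
  rewrite annihilate1_in ?inE ?xS ?orbT// create1_out ?inE ?negb_and ?yS ?orbT//.
  rewrite !scalerA koszulD1// koszulU1// (koszul_swap xy).
  rewrite (_ : (y |` S) `\ x = y |` (S `\ x))%fset; last first.
    apply/fsetP => z; rewrite !inE.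
    by have [->|] := eqVneq z y; rewrite ?yx ?andbT.
  by rewrite -scalerDl [X in X *: _](_ : _ = 0) ?scale0r//; ring.
- rewrite [create1 _ y S]create1_out// [annihilate1 _ x S]annihilate1_out//.
  rewrite lext0 lextZ annihilate1_out ?scaler0 ?addr0//.
  by rewrite !inE (negbTE xS) (negbTE xy).
Qed.

Lemma create_linear x : linear (create x : V -> V).
Proof. exact: lext_linear. Qed.

Lemma annihilate_linear x : linear (annihilate x : V -> V).
Proof. exact: lext_linear. Qed.

HB.instance Definition _ x :=
  GRing.isLinear.Build C V V *:%R (create x : V -> V) (create_linear x).
HB.instance Definition _ x :=
  GRing.isLinear.Build C V V *:%R (annihilate x : V -> V) (annihilate_linear x).

Lemma smode_linear (x : symbol ty n) (j : int) : linear (smode x j : V -> V).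
Proof.
case: j => p a u v; last exact: create_linear.
rewrite /smode scaler_sumr -big_split; apply: eq_bigr => y _.
exact: annihilate_linear.
Qed.

Lemma smode0 (x : symbol ty n) (j : int) : smode x j (0 : V) = 0.
Proof.
by have := smode_linear x j (-1) 0 0; rewrite scaler0 addr0 scaleN1r addNr.
Qed.

Lemma smode_vacuum (x : symbol ty n) (p : nat) :
  smode x p%:Z (vacuum : V) = 0.
Proof.
by rewrite /= big1// => y _; rewrite /annihilate lext_basis annihilate1_out.
Qed.

Lemma sform_sym (x y : symbol ty n) : sform x y = sform y x.
Proof.
case: x y => [[a|a]|g] [[b|b]|h] //=; rewrite /pform.
- by have [->|] := eqVneq a b; rewrite ?andbF.
- by have [->|] := eqVneq a b; rewrite ?andbF.
- by rewrite /ghost_form; case: ty g h => // g h; rewrite eq_sym.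
Qed.

Lemma smode_car (x y : symbol ty n) (i j : int) v :
  smode x i (smode y j v) + smode y j (smode x i v)
  = (sform x y && (i == - j - 1))%:R *: v.
Proof.
have key (x' y' : symbol ty n) p q (w : V) : smode x' (Posz p) (smode y' (Negz q) w)
    + smode y' (Negz q) (smode x' (Posz p) w) = (sform x' y' && (p == q))%:R *: w.
  rewrite /= linear_sum -big_split /=.
  under eq_bigr do rewrite annihilate_create xpair_eqE.
  rewrite -scaler_suml; congr (_ *: _).
  have [xy|xy] := boolP (sform x' y').
    rewrite (bigD1 y')//= eqxx big1 ?addr0// => z /andP[_ /negbTE ->].
    by [].
  rewrite big1// => z xz; case: eqVneq => // e.
  by rewrite e (negbTE xy) in xz.
case: i j => [p|p] [q|q].
- rewrite [X in _ && X](_ : _ = false) ?andbF ?scale0r; last first.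
    by apply/negbTE; rewrite eq_sym; lia.
  have E (x' y' : symbol ty n) p' q' : smode x' (Posz p') (smode y' (Posz q') v)
      = \sum_(z | sform x' z) \sum_(t | sform y' t)
          annihilate (z, p') (annihilate (t, q') v).
    by rewrite /=; apply: eq_bigr => z _; rewrite linear_sum.
  rewrite !E [X in _ + X]exchange_big -big_split big1//= => z _.
  by rewrite -big_split big1//= => t _; exact: annihilate_annihilate.
- by rewrite key; congr ((_ && _)%:R *: _); lia.
- by rewrite addrC key sform_sym; congr ((_ && _)%:R *: _); lia.
- rewrite [X in _ && X](_ : _ = false) ?andbF ?scale0r; last lia.
  exact: create_create.
Qed.

Lemma annihilate_large v : exists B : nat,
  forall (x : symbol ty n) (p : nat), (B <= p)%N -> smode x p%:Z v = 0.
Proof.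
pose m S := (\max_(y <- (S : {fset cr})) y.2.+1)%N.
exists (\max_(S <- msupp (v : {malg C[{fset cr}]})) m S)%N => x p Bp.
rewrite /= big1// => y _; rewrite /annihilate /lext big1_seq// => S /= vS.
rewrite annihilate1_out ?scaler0//; apply/negP => yS.
have : (p.+1 <= p)%N.
  apply: leq_trans Bp; apply: (@leq_trans (m S)).
    exact: (@leq_bigmax_seq _ (enum_fset S) xpredT (fun y : cr => y.2.+1) (y, p)).
  exact: (@leq_bigmax_seq _ (enum_fset (msupp (v : {malg C[{fset cr}]}))) xpredT m S).
by rewrite ltnn.
Qed.

Lemma nop_finite (a b : svect R ty n) (k : int) v :
  finite_set [set i : int | nop_mode a b i (k - 1 - i) v != 0].
Proof.
have [B vB] := annihilate_large v.
pose N := (B + absz k + 1)%N.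
apply: (@sub_finite_set _ _
  [set` [seq (m%:Z - N%:Z : int) | m <- iota 0 (2 * N)]]); last exact: finite_seq.
move=> i /= /eqP; move: (i : int) => {}i hi.
have Ni : - N%:Z <= i < N%:Z.
  apply: contrapT => /negP h; apply: hi; rewrite /nop_mode big1// => x _.
  rewrite big1// => y _; rewrite /snop; case: (is_c x || is_c y).
    by rewrite scaler0.
  have [i0|i0] := ltP i 0.
    rewrite (_ : k - 1 - i = (absz (k - 1 - i)%R)%:Z); last by lia.
    by rewrite vB ?smode0 ?scaler0//; lia.
  rewrite (_ : i = (absz i)%:Z); last by lia.
  by rewrite vB ?smode0 ?oppr0 ?scaler0//; lia.
apply/mapP; exists (absz (i + N%:Z)%R); last by lia.
by rewrite mem_iota; lia.
Qed.

End CliffordRelations.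

Section Assignment.
Context (R : realType) (ty : ttype) (n : nat).

Local Notation C := R[i].
Local Notation F := (field R ty n).

Definition csqrt (m : nat) : C := (Num.sqrt (m%:R : R))%:C%C.

(* exp(2 pi sqrt(-1) / 3) *)
Definition omega : C :=
  (cos (2 * pi / 3 : R) +i* sin (2 * pi / 3 : R))%C.

Definition beta : pvect R n :=
  match ty with
  | A2nm1 => - (csqrt 2 *: cc)
  | Dnp1 => - cc
  | A2n => - ((csqrt 2)^-1 *: cc)
  | D4 => - (csqrt 3 *: cc)
  end + eps 1.

Local Notation e_ i := (vec (eps i) : svect R ty n).
Local Notation es_ i := (star (eps i) : svect R ty n).
Local Notation b_ i := (vec (epsb i) : svect R ty n).
Local Notation bs_ i := (star (epsb i) : svect R ty n).
Local Notation beta_ := (vec beta : svect R ty n).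
Local Notation betas_ := (star beta : svect R ty n).
Local Notation ge := (ghost 0 : svect R ty n).
Local Notation gebar := (ghost 1 : svect R ty n).

Definition X0 (s : bool) : F :=
  match ty, s with
  | A2nm1, true => nop (b_ 2) betas_ + nop (es_ 2) (b_ 1)
  | A2nm1, false => nop beta_ (bs_ 2) + nop (bs_ 1) (e_ 2)
  | Dnp1, true => csqrt 2 *: nop gebar betas_
  | Dnp1, false => csqrt 2 *: nop beta_ gebar
  | A2n, true => nop (b_ 1) betas_
  | A2n, false => nop beta_ (bs_ 1)
  | D4, true =>
      nop (b_ 1) betas_ + omega *: nop (bs_ 1) (es_ 1)
      + omega ^+ 2 *: nop (bs_ 2) (es_ 2)
  | D4, false =>
      nop beta_ (bs_ 1) + omega ^+ 2 *: nop (e_ 1) (b_ 1)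
      + omega *: nop (e_ 2) (b_ 2)
  end.

Definition Xmid (s : bool) (i : nat) : F :=
  match ty, s with
  | A2nm1, true | A2n, true =>
      nop (e_ i) (es_ i.+1) + nop (bs_ i) (b_ i.+1)
  | A2nm1, false | A2n, false =>
      nop (e_ i.+1) (es_ i) + nop (bs_ i.+1) (b_ i)
  | Dnp1, true => nop (e_ i) (es_ i.+1)
  | Dnp1, false => nop (e_ i.+1) (es_ i)
  | D4, true =>
      nop (e_ 1) (es_ 2) + nop (b_ 2) (bs_ 1) + nop (b_ 2) (b_ 1)
  | D4, false =>
      nop (e_ 2) (es_ 1) + nop (b_ 1) (bs_ 2) + nop (bs_ 1) (bs_ 2)
  end.

Definition Xn (s : bool) : F :=
  match ty, s with
  | A2nm1, true | D4, true => nop (e_ n) (bs_ n)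
  | A2nm1, false | D4, false => nop (b_ n) (es_ n)
  | Dnp1, true => csqrt 2 *: nop (e_ n) ge
  | Dnp1, false => csqrt 2 *: nop ge (es_ n)
  | A2n, true => csqrt 2 *: (nop (e_ n) gebar + nop (bs_ n) ge)
  | A2n, false => csqrt 2 *: (nop ge (es_ n) + nop gebar (b_ n))
  end.

Definition alpha0 : F :=
  match ty with
  | A2nm1 =>
      nop betas_ beta_ + nop (es_ 2) (e_ 2)
      + nop (b_ 1) (bs_ 1) + nop (b_ 2) (bs_ 2)
  | Dnp1 => 2 *: nop betas_ beta_
  | A2n => nop (b_ 1) (bs_ 1) + nop betas_ beta_
  | D4 =>
      nop (es_ 1) (e_ 1) + nop betas_ beta_
      + nop (es_ 2) (e_ 2) + nop (bs_ 2) (b_ 2)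
  end.

Definition alphamid (i : nat) : F :=
  match ty with
  | A2nm1 | A2n =>
      nop (e_ i) (es_ i) + nop (es_ i.+1) (e_ i.+1)
      + nop (bs_ i) (b_ i) + nop (b_ i.+1) (bs_ i.+1)
  | Dnp1 => nop (e_ i) (es_ i) + nop (es_ i.+1) (e_ i.+1)
  | D4 =>
      nop (e_ 1) (es_ 1) + nop (es_ 2) (e_ 2) + 2 *: nop (b_ 2) (bs_ 2)
  end.

Definition alphan : F :=
  match ty with
  | A2nm1 | D4 => nop (e_ n) (es_ n) + nop (bs_ n) (b_ n)
  | Dnp1 => 2 *: nop (e_ n) (es_ n)
  | A2n => 2 *: (nop (e_ n) (es_ n) + nop (bs_ n) (b_ n))
  end.

(* X_field s i is X(alpha_i, z) for s = true and X(-alpha_i, z) for s = false. *)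
Definition X_field (s : bool) (i : 'I_n.+1) : F :=
  if i == 0 :> nat then X0 s else if i == n :> nat then Xn s else Xmid s i.

Definition alpha_field (i : 'I_n.+1) : F :=
  if i == 0 :> nat then alpha0 else if i == n :> nat then alphan
  else alphamid i.

Definition is_level_1_0 (rho : t_alg R ty n -> fock R ty n -> fock R ty n) : Prop :=
  (forall v, rho (t_c R ty n) v = v) /\ (forall v, rho (t_c1 R ty n) v = 0).

End Assignment.

Arguments X_field R ty {n} s i.
Arguments alpha_field R ty {n} i.

(* Main.v *)
(* Off the central symbols, the modes of the normal ordered quadratic products
   :x(z) y(z): close under commutators up to a scalar, so that an antisymmetric
   tensor M on the symbols acts by modes M(k) with
     [M(k), N(l)] = [M, N](k + l) + k delta_(k,-l) (M | N),
   where [M, N] = M J N - N J M, J is the Gram matrix of the symbols and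
   (M | N) = tr(M J N J) / 2.  This is the level one spinor representation of an
   affine orthogonal algebra.  Write h_i, e_i, f_i for the tensors of
   alpha_i(z), X(alpha_i, z), X(-alpha_i, z), where beta may be replaced by
   eps_1.  It suffices to check
     [h_i, e_j] = a_ij e_j,  [h_i, f_j] = - a_ij f_j,  [e_i, f_j] = delta_ij h_i,
     (e_i | f_i) = nu_i:
   the remaining values of the invariant form follow by weights, as in
   (h_i | h_j) = (h_i | [e_j, f_j]) = a_ij nu_j, and the Serre relations hold in
   every finite dimensional representation of sl_2. *)
Require Import Defs.
From HB Require Import structures.
From mathcomp Require Import all_boot all_order all_algebra.
From mathcomp Require Import finmap.
From mathcomp Require Import boolp classical_sets functions cardinality fsbigop.
From mathcomp Require Import reals trigo complex ring lra zify.

Set Implicit Arguments.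
Unset Strict Implicit.
Unset Printing Implicit Defensive.

Import Order.TTheory GRing.Theory Num.Theory.

Local Open Scope ring_scope.

(** * Sums with finite support *)

Section FiniteSums.
Context {T : choiceType}.
Implicit Types V W : zmodType.

(** A relation rather than a sum operator: derivations add, scale and re-index finite sums without
    tracking supports, and [has_fsum_unique] turns two derivations into an equation. *)
Definition has_fsum V (f : T -> V) (s : V) : Prop :=
  exists2 A : {fset T}, forall i, i \notin A -> f i = 0 & s = \sum_(i <- A) f i.

Lemma has_fsum_widen V (f : T -> V) (A B : {fset T}) :
  (A `<=` B)%fset -> (forall i, i \notin A -> f i = 0) ->
  \sum_(i <- A) f i = \sum_(i <- B) f i.
Proof. by move=> AB f0; apply: big_fset_incl => // i _ /f0. Qed.

Lemma has_fsum_unique V (f : T -> V) s s' : has_fsum f s -> has_fsum f s' -> s = s'.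
Proof.
move=> [A fA ->] [B fB ->].
by rewrite (has_fsum_widen (fsubsetUl A B))// (has_fsum_widen (fsubsetUr A B)).
Qed.

Lemma eq_has_fsum V (f g : T -> V) s : f =1 g -> has_fsum f s -> has_fsum g s.
Proof. by move=> /funext ->. Qed.

Lemma has_fsumT V (f : T -> V) s :
  has_fsum f s -> \sum_(i \in [set: T]%classic) f i = s.
Proof. by move=> [A fA ->]; exact: fsbigTE. Qed.

Lemma has_fsum_finite V (f : T -> V) :
  finite_set [set i | f i != 0]%classic ->
  has_fsum f (\sum_(i \in [set: T]%classic) f i).
Proof.
move=> fin; exists (fset_set [set i | f i != 0]%classic).
  by move=> i; rewrite in_fset_set// => /negP; rewrite in_setE /= => /negP/negPn/eqP.
by apply: fsbigTE => i; rewrite in_fset_set// => /negP; rewrite in_setE /= => /negP/negPn/eqP.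
Qed.

Lemma has_fsum0 V : has_fsum (fun=> 0 : V) 0.
Proof. by exists fset0 => //; rewrite big1. Qed.

Lemma has_fsumD V (f g : T -> V) s t :
  has_fsum f s -> has_fsum g t -> has_fsum (fun i => f i + g i) (s + t).
Proof.
move=> [A fA ->] [B gB ->]; exists (A `|` B)%fset.
  by move=> i; rewrite inE negb_or => /andP[iA iB]; rewrite fA// gB// addr0.
rewrite big_split (has_fsum_widen (fsubsetUl A B))//.
by rewrite (has_fsum_widen (fsubsetUr A B)).
Qed.

Lemma has_fsum_additive V W (g : V -> W) (f : T -> V) s :
  (forall x y, g (x - y) = g x - g y) -> has_fsum f s -> has_fsum (g \o f) (g s).
Proof.
move=> gB [A fA ->].
have g0 : g 0 = 0 by rewrite -(subrr 0) gB subrr.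
have gN x : g (- x) = - g x by rewrite -sub0r gB g0 sub0r.
exists A => [i /fA /= ->//|]; apply: (big_morph g) => // x y.
by rewrite -[y in LHS]opprK gB gN opprK.
Qed.

Lemma has_fsumN V (f : T -> V) s : has_fsum f s -> has_fsum (fun i => - f i) (- s).
Proof. by apply: (has_fsum_additive (g := -%R)) => x y; rewrite opprB opprK addrC. Qed.

Lemma has_fsumB V (f g : T -> V) s t :
  has_fsum f s -> has_fsum g t -> has_fsum (fun i => f i - g i) (s - t).
Proof. by move=> fs /has_fsumN; exact: has_fsumD. Qed.

Lemma has_fsum_scale (K : pzRingType) (V : lmodType K) (a : K) (f : T -> V) s :
  has_fsum f s -> has_fsum (fun i => a *: f i) (a *: s).
Proof. by apply: (has_fsum_additive (g := *:%R a)) => x y; rewrite scalerBr. Qed.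

Lemma has_fsum_bij V (h h' : T -> T) (f : T -> V) s :
  cancel h h' -> cancel h' h -> has_fsum f s -> has_fsum (f \o h) s.
Proof.
move=> hK h'K [A fA ->]; exists [fset h' i | i in A]%fset.
  move=> i iA /=; apply: fA; apply: contra iA => iA.
  by apply/imfsetP; exists (h i); rewrite ?hK.
rewrite big_imfset /=; last by move=> x y _ _; exact: can_inj h'K _ _.
by apply: eq_bigr => i _; rewrite h'K.
Qed.

Lemma has_fsum_delta V (i0 : T) (v : V) :
  has_fsum (fun i => if i == i0 then v else 0) v.
Proof.
exists [fset i0]%fset; first by move=> i; rewrite inE => /negbTE ->.
by rewrite big_seq_fset1 eqxx.
Qed.

End FiniteSums.

(* Moving the splitting point of a normal ordering by [k] crosses [k] modes. *)
Lemma has_fsum_step (V : zmodType) (k : int) (v : V) :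
  has_fsum (fun j : int => v *+ (j < 0)%R - v *+ (j + k < 0)%R) (v *~ k).
Proof.
have shift (m : int) : has_fsum
    (fun j : int => v *+ (j + m < 0)%R - v *+ (j + (m + 1) < 0)%R) v.
  apply: eq_has_fsum (has_fsum_delta (- m - 1) v) => j; rewrite /=.
  have [->|jm] := eqVneq.
    rewrite (_ : - m - 1 + m < 0 = true); last by lia.
    by rewrite (_ : - m - 1 + (m + 1) < 0 = false) ?subr0//; lia.
  by rewrite (_ : (j + (m + 1) < 0) = (j + m < 0)) ?subrr//; lia.
elim/int_ind: k => [|m IH|m IH].
- rewrite mulr0z; apply: eq_has_fsum (has_fsum0 V) => j.
  by rewrite addr0 subrr.
- have -> : v *~ m.+1 = v *~ m + v by rewrite -addn1 PoszD mulrzDr.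
  apply: eq_has_fsum (has_fsumD IH (shift m%:Z)) => j.
  by rewrite /= addrA subrK -addn1 PoszD.
- have -> : v *~ (- m.+1%:Z) = v *~ (- m%:Z) - v.
    by rewrite -addn1 PoszD opprD mulrzDr.
  apply: eq_has_fsum (has_fsumB IH (shift (- m%:Z - 1))) => j.
  by rewrite /= subrK opprB addrA subrK -addn1 PoszD opprD.
Qed.

(** * Commutators of normal ordered quadratic modes *)

Section NormalOrdering.
Context {C : comNzRingType} {V : lmodType C} {S : finType}.
Context (sf : rel S) (central : pred S) (mode : S -> int -> {linear V -> V}).
Context (sf_central : forall x y, central x -> sf x y = false)
        (sfC : symmetric sf)
        (car : forall x y i j v, mode x i (mode y j v) + mode y j (mode x i v)
                                 = (sf x y && (i == - j - 1))%:R *: v)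
        (smooth : forall v, exists B : nat,
                    forall x (p : nat), (B <= p)%N -> mode x p%:Z v = 0).
Implicit Types (x y z t : S) (i j k l : int) (v : V).

(** The counterpart of [snop] for arbitrary modes satisfying the Clifford relations. *)
Definition bsnop x y i j v : V :=
  if central x || central y then 0
  else if i < 0 then mode x i (mode y j v)
  else - mode y j (mode x i v).

Lemma bsnop_linear x y i j : linear (bsnop x y i j).
Proof.
move=> a u v; rewrite /bsnop; case: ifP => _; first by rewrite scaler0 addr0.
by case: ifP => _; rewrite !linearP ?opprD ?scalerN.
Qed.

HB.instance Definition _ x y i j :=
  GRing.isLinear.Build C V V *:%R (bsnop x y i j) (bsnop_linear x y i j).

Definition bnop x y k v : V :=
  \sum_(i \in [set: int]%classic) bsnop x y i (k - 1 - i) v.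

Lemma has_fsum_bnop x y k v :
  has_fsum (fun i => bsnop x y i (k - 1 - i) v) (bnop x y k v).
Proof.
apply: has_fsum_finite.
have [B vB] := smooth v.
(* For [i < - N] the index [k - 1 - i] is at least [B], and for [i >= N] the index [i] is. In either
   case the mode that acts first kills [v]. *)
pose N := (B + absz k + 1)%N.
apply: (@sub_finite_set _ _
  [set` [seq (m%:Z - N%:Z : int) | m <- iota 0 (2 * N)]]); last exact: finite_seq.
move=> i /= /eqP hi.
have Ni : - N%:Z <= i < N%:Z.
  apply: contrapT => /negP h; apply: hi; rewrite /bsnop; case: ifP => // _.
  have [i0|i0] := ltP i 0.
    rewrite (_ : k - 1 - i = (absz (k - 1 - i)%R)%:Z); last by lia.
    by rewrite vB ?linear0//; lia.
  rewrite (_ : i = (absz i)%:Z); last by lia.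
  by rewrite vB ?linear0 ?oppr0//; lia.
apply/mapP; exists (absz (i + N%:Z)%R); last by lia.
by rewrite mem_iota; lia.
Qed.

Lemma bnop_linear x y k : linear (bnop x y k).
Proof.
move=> a u v; apply: has_fsum_unique (has_fsum_bnop _ _ _ _) _.
have := has_fsumD (has_fsum_scale a (has_fsum_bnop x y k u)) (has_fsum_bnop x y k v).
by apply: eq_has_fsum => i /=; rewrite linearP.
Qed.

HB.instance Definition _ x y k :=
  GRing.isLinear.Build C V V *:%R (bnop x y k) (bnop_linear x y k).

Lemma bnop_central x y k v : central x || central y -> bnop x y k v = 0.
Proof.
by move=> c; apply: has_fsumT; apply: eq_has_fsum (has_fsum0 _) => i; rewrite /bsnop c.
Qed.

Lemma mode_anti x y i j v : i != - j - 1 ->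
  mode x i (mode y j v) = - mode y j (mode x i v).
Proof.
move=> /negbTE ij; apply/eqP; rewrite -addr_eq0 car ij andbF.
by rewrite scale0r.
Qed.

(** Substitute [i] by [k - 1 - i]. The two orderings differ only when both indices lie on the same
    side of 0; their sum is then not $-1$, so the modes anticommute. *)
Lemma bnop_anti x y k v : bnop x y k v = - bnop y x k v.
Proof.
have := has_fsumN (has_fsum_bnop y x k v).
move=> /(has_fsum_bij (h := fun i => k - 1 - i) (h' := fun i => k - 1 - i)) H.
apply: has_fsum_unique (has_fsum_bnop x y k v) _.
have K : cancel (fun i => k - 1 - i) (fun i => k - 1 - i) by move=> i; lia.
apply: eq_has_fsum (H K K) => i; rewrite /= (_ : k - 1 - (k - 1 - i) = i); last by lia.
rewrite /bsnop orbC; case: ifP => _; first by rewrite oppr0.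
case: ifP => i0; case: ifP => j0; rewrite ?opprK//.
- by rewrite mode_anti ?opprK//; lia.
- by rewrite mode_anti ?opprK//; lia.
Qed.

Lemma bsnop_mode x y z i i' j v : ~~ central x -> ~~ central y ->
  bsnop x y i i' (mode z j v) - mode z j (bsnop x y i i' v)
  = (sf y z && (i' == - j - 1))%:R *: mode x i v
    - (sf x z && (i == - j - 1))%:R *: mode y i' v.
Proof.
move=> /negbTE xc /negbTE yc; rewrite /bsnop xc yc /=.
have swap x' k w :
    mode x' k (mode z j w) = (sf x' z && (k == - j - 1))%:R *: w - mode z j (mode x' k w).
  by rewrite -car addrK.
case: ifP => _.
  by rewrite swap linearB linearZ swap opprB addrA addrAC addrK.
rewrite linearN swap linearB linearZ swap !opprB linearN opprK.
by rewrite addrAC subrK.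
Qed.

(** A quadratic mode acts on a single mode as a derivation. Only two indices survive in the sum:
    [j + k], where [y] meets [z], and [- j - 1], where [x] meets [z]. *)
Lemma bnop_mode x y z k j v : ~~ central x -> ~~ central y ->
  bnop x y k (mode z j v) - mode z j (bnop x y k v)
  = (sf y z)%:R *: mode x (j + k) v - (sf x z)%:R *: mode y (j + k) v.
Proof.
move=> xc yc.
have H := has_fsumB (has_fsum_bnop x y k (mode z j v))
  (has_fsum_additive (linearB (mode z j)) (has_fsum_bnop x y k v)).
apply: has_fsum_unique H _.
have := has_fsumB (has_fsum_delta (j + k) ((sf y z)%:R *: mode x (j + k) v))
  (has_fsum_delta (- j - 1) ((sf x z)%:R *: mode y (j + k) v)).
apply: eq_has_fsum => i; rewrite /= bsnop_mode//.
congr (_ - _).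
  have [->|ijk] := eqVneq.
    by rewrite (_ : k - 1 - (j + k) == - j - 1) ?andbT//; lia.
  by rewrite (_ : (k - 1 - i == - j - 1) = false) ?andbF ?scale0r//; lia.
have [->|ijk] := eqVneq; last by rewrite andbF scale0r.
by rewrite andbT (_ : k - 1 - (- j - 1) = j + k)//; lia.
Qed.

(** The index of [x] is [j + k] while the order is still decided by the sign of [j]. Sorting by the
    sign of [j + k] instead changes [k] terms, counted with sign, each by an anticommutator: this is
    the source of the central term. *)
Lemma has_fsum_bsnop_shift x t k l v : ~~ central x -> ~~ central t ->
  has_fsum (fun j => if j < 0 then mode x (j + k) (mode t (l - 1 - j) v)
                     else - mode t (l - 1 - j) (mode x (j + k) v))
    (bnop x t (k + l) v + ((sf x t && (k == - l))%:R *: v) *~ k).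
Proof.
move=> /negbTE xc /negbTE tc.
have H := has_fsum_bij (h := fun j => j + k) (h' := fun j => j - k)
  (addrK k) (subrK k) (has_fsum_bnop x t (k + l) v).
have := has_fsumD H (has_fsum_step k ((sf x t && (k == - l))%:R *: v)).
apply: eq_has_fsum => j /=; rewrite /bsnop xc tc /=.
rewrite (_ : k + l - 1 - (j + k) = l - 1 - j); last by lia.
have := car x t (j + k) (l - 1 - j) v.
rewrite (_ : (j + k == - (l - 1 - j) - 1) = (k == - l)); last by lia.
move=> <-; case: ifP => _; case: ifP => _; 
  rewrite /= ?mulr0n ?mulr1n ?subr0 ?sub0r ?subrr ?addr0//.
  by rewrite opprD addrA subrr add0r.
by rewrite addrC addrK.
Qed.

(** By [bnop_mode], the first product acts as a derivation on each term of the second. Replacing [z]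
    shifts the index that decides the order and yields a central term through
    [has_fsum_bsnop_shift]; replacing [t] leaves that index alone and yields none. *)
Lemma bnop_bnop x y z t k l v :
  bnop x y k (bnop z t l v) - bnop z t l (bnop x y k v)
  = (sf y z)%:R *: bnop x t (k + l) v - (sf x z)%:R *: bnop y t (k + l) v
    + (sf y t)%:R *: bnop z x (k + l) v - (sf x t)%:R *: bnop z y (k + l) v
    + ((k * (k == - l)%:Z)%:~R *
       ((sf y z)%:R * (sf x t)%:R - (sf x z)%:R * (sf y t)%:R)) *: v.
Proof.
have [c|] := boolP (central x || central y || (central z || central t)).
  have bl w u m v' : central w -> bnop w u m v' = 0 by move=> wc; rewrite bnop_central ?wc.
  have br w u m v' : central w -> bnop u w m v' = 0.
    by move=> wc; rewrite bnop_central ?wc ?orbT.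
  have sr w u : central w -> sf u w = false by move=> wc; rewrite sfC sf_central.
  case/orP: c => /orP[] c; rewrite ?(bl _ _ _ _ c) ?(br _ _ _ _ c)
    ?(sf_central _ c) ?(sr _ _ c);
    by rewrite ?linear0 ?scaler0 ?scale0r ?mul0r ?mulr0 ?subrr ?mulr0 ?scale0r ?addr0 ?subrr.
rewrite !negb_or => /andP[/andP[xc yc] /andP[zc tc]].
have H := has_fsumB
  (has_fsum_additive (linearB (bnop x y k)) (has_fsum_bnop z t l v))
  (has_fsum_bnop z t l (bnop x y k v)).
apply: has_fsum_unique H _.
have Hxt := has_fsum_scale (sf y z)%:R (has_fsum_bsnop_shift k l v xc tc).
have Hyt := has_fsum_scale (sf x z)%:R (has_fsum_bsnop_shift k l v yc tc).
have Hzx := has_fsum_scale (sf y t)%:R (has_fsum_bnop z x (k + l) v).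
have Hzy := has_fsum_scale (sf x t)%:R (has_fsum_bnop z y (k + l) v).
have := has_fsumB (has_fsumD (has_fsumB Hxt Hyt) Hzx) Hzy.
have jumpE (b : bool) : ((b && (k == - l))%:R *: v) *~ k
    = ((k * (k == - l)%:Z)%:~R * b%:R) *: v.
  by rewrite -scaler_int scalerA -mulnb natrM intrM mulrCA mulrC.
set s := (X in has_fsum _ X); set s' := (X in _ -> has_fsum _ X).
have -> : s' = s.
  rewrite /s /s' !jumpE mulrBr scalerBl !scalerDr !scalerA.
  rewrite (mulrCA (sf y z)%:R) (mulrCA (sf x z)%:R).
  apply: esym; rewrite opprD addrACA -[LHS]addrA [LHS]addrAC.
  by congr (_ + _); rewrite addrA.
apply: eq_has_fsum => j /=.
rewrite /bsnop (negbTE xc) (negbTE yc) (negbTE zc) (negbTE tc) /=.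
have A w i u : bnop x y k (mode w i u) = mode w i (bnop x y k u) +
    ((sf y w)%:R *: mode x (i + k) u - (sf x w)%:R *: mode y (i + k) u).
  by rewrite -bnop_mode// addrC subrK.
rewrite (_ : k + l - 1 - j = l - 1 - j + k); last by lia.
apply: esym; case: ifP => _.
  rewrite !A linearD linearB !linearZ /= !scalerN -(addrA (mode z j _)).
  by rewrite [LHS]addrAC subrr add0r addrC addrA.
rewrite (linearN (bnop x y k)) /= opprK !A (linearD (mode t _)) (linearB (mode t _)).
rewrite !(linearZ_LR (mode t _)) /= -(addrA (mode t _ _)).
rewrite !scalerN opprD [LHS]addrAC addNr add0r opprD !opprB !opprK.
by rewrite [in RHS](addrC (- _)) -[RHS]addrA; congr (_ + _); rewrite addrC.
Qed.
End NormalOrdering.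

(** * The twisted commutator and the Serre relations *)

(** Otherwise the [u p] with [p >= N] would be eigenvectors for more distinct eigenvalues than the
    characteristic polynomial has roots. *)
Lemma eigen_sequence_vanishes (F : fieldType) (m : nat)
    (f : {linear 'M[F]_m -> 'M[F]_m}) (c : nat -> F) (u : nat -> 'M[F]_m) (N : nat) :
  injective c -> (forall p, f (u p) = c p *: u p) -> exists2 p, (N <= p)%N & u p = 0.
Proof.
move=> cI fu; apply: contrapT => u0.
have {}u0 p : (N <= p)%N -> u p != 0.
  by move=> Np; apply/eqP => up0; apply: u0; exists p.
pose A := lin_mx f; pose s := [seq c p | p <- iota N (size (char_poly A))].
have := @max_poly_roots _ _ s (monic_neq0 (char_poly_monic A)).
rewrite size_map size_iota ltnn => H.
suff: false by []. apply: H; last by rewrite map_inj_uniq ?iota_uniq.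
apply/allP => _ /mapP[p + ->]; rewrite mem_iota => /andP[Np _].
rewrite -eigenvalue_root_char; apply/eigenvalueP; exists (mxvec (u p)).
  by rewrite mul_vec_lin fu linearZ.
by rewrite mxvec_eq0 u0.
Qed.

Section TwistedCommutator.
Context {F : comNzRingType} {m : nat} (J : 'M[F]_m).
Implicit Types M N P : 'M[F]_m.

(** The map $M\mapsto MJ$ carries this bracket to the matrix commutator and [mxform] to the trace
    form, whence the Jacobi identity and invariance. *)
Definition mxlie M N := M *m J *m N - N *m J *m M.

Definition mxform M N := \tr (M *m J *m (N *m J)).

Lemma mxlie_linear M : linear (mxlie M).
Proof.
move=> a N P; rewrite /mxlie linearP /= !mulmxDl -!scalemxAl scalerBr.
by rewrite opprD addrACA.
Qed.

HB.instance Definition _ M :=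
  GRing.isLinear.Build F 'M[F]_m 'M[F]_m *:%R (mxlie M) (mxlie_linear M).

Lemma mxlie_anti M N : mxlie M N = - mxlie N M.
Proof. by rewrite /mxlie opprB. Qed.

Lemma mxliexx M : mxlie M M = 0. Proof. exact: subrr. Qed.

Lemma mxlieDl M N P : mxlie (M + N) P = mxlie M P + mxlie N P.
Proof. by rewrite mxlie_anti (linearD (mxlie P)) opprD -!mxlie_anti. Qed.

Lemma mxlieZl a M P : mxlie (a *: M) P = a *: mxlie M P.
Proof. by rewrite mxlie_anti (linearZ_LR (mxlie P)) -scalerN -mxlie_anti. Qed.

Lemma mxlieNl M P : mxlie (- M) P = - mxlie M P.
Proof. by rewrite -scaleN1r mxlieZl scaleN1r. Qed.

Lemma mxlie_jacobi M N P :
  mxlie M (mxlie N P) = mxlie (mxlie M N) P + mxlie N (mxlie M P).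
Proof.
rewrite /mxlie !(mulmxBl, mulmxBr) !mulmxA.
by apply/matrixP => i j; rewrite !mxE; ring.
Qed.

Lemma mxformC M N : mxform M N = mxform N M.
Proof. exact: mxtrace_mulC. Qed.

Lemma mxformZr a M N : mxform M (a *: N) = a * mxform M N.
Proof. by rewrite /mxform -scalemxAl -scalemxAr mxtraceZ. Qed.

Lemma mxform_lie M N P : mxform (mxlie M N) P = mxform M (mxlie N P).
Proof.
have E A B : mxlie A B *m J = A *m J *m (B *m J) - B *m J *m (A *m J).
  by rewrite /mxlie mulmxBl !mulmxA.
rewrite /mxform !E; move: (M *m J) (N *m J) (P *m J) => A B D.
by rewrite mulmxBl mulmxBr !linearB /= -(mulmxA A B D) -(mulmxA B A D) 
  (mxtrace_mulC B) -(mulmxA A D B).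
Qed.

End TwistedCommutator.

(* The Serre relations follow from the [sl_2] relations: for [u_p = (ad e)^p x]
   one has [[f, u_p] = - p (a + p - 1) u_(p-1)], the [u_p] have distinct
   [h]-weights and hence vanish for some large [p], and the coefficient is
   nonzero for [p > 1 - a], so that one can descend to [p = 1 - a]. *)
Lemma mxlie_serre (F : numFieldType) (m : nat) (J e f h x : 'M[F]_m) (a : int) (N : nat) :
  mxlie J e f = h -> mxlie J h e = 2 *: e -> mxlie J h x = a%:~R *: x ->
  mxlie J f x = 0 -> N%:Z = 1 - a -> iter N (mxlie J e) x = 0.
Proof.
move=> ef he hx fx Na; pose u p := iter p (mxlie J e) x.
have hu p : mxlie J h (u p) = (a + p.*2%:Z)%:~R *: u p.
  elim: p => [|p IH]; first by rewrite addr0.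
  rewrite /= mxlie_jacobi he mxlieZl IH linearZ -scalerDl; congr (_ *: _).
  by rewrite -(intrD F 2) doubleS; congr (_%:~R); lia.
have fu p : mxlie J f (u p.+1) = - ((p.+1)%:Z * (a + p%:Z))%:~R *: u p.
  elim: p => [|p IH]; rewrite /= mxlie_jacobi (mxlie_anti J f e) ef mxlieNl.
    by rewrite hx fx linear0 addr0 mul1r addr0 scaleNr.
  rewrite -[mxlie J e (u p)]/(u p.+1) (hu p.+1) IH (linearZ_LR (mxlie J e)) /=
    -[mxlie J e (u p)]/(u p.+1).
  rewrite -scaleNr -scalerDl; congr (_ *: _).
  by rewrite -!intrN -intrD; congr (_%:~R); rewrite -muln2; lia.
have [|p Np up] := @eigen_sequence_vanishes _ _ (mxlie J h)
    (fun p => (a + p.*2%:Z)%:~R) u N _ hu.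
  by move=> p q /eqP; rewrite eqr_int => /eqP; lia.
elim: p Np up => [|p IH]; first by rewrite leqn0 => /eqP ->.
rewrite leq_eqVlt => /orP[/eqP -> //|Np] up; apply: IH => //.
have := fu p; rewrite up linear0 => /esym/eqP; rewrite scaler_eq0 oppr_eq0 intr_eq0.
by rewrite mulf_eq0 => /orP[|/eqP//]; lia.
Qed.

(** * Quadratic operators *)

(** Coefficients at central symbols are left free because [s] vanishes there; this is what allows
    $\beta$ to be replaced by $\varepsilon_1$. *)
Lemma sum_indicator2 (C : pzRingType) (V : lmodType C) (S : finType) (central : pred S)
    (a b : S -> C) (s : S -> S -> V) x y :
  (forall z t, central z || central t -> s z t = 0) ->
  (forall z, ~~ central z -> a z = (z == x)%:R) ->
  (forall z, ~~ central z -> b z = (z == y)%:R) ->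
  \sum_z \sum_t (a z * b t) *: s z t = s x y.
Proof.
move=> s0 ax bY.
have E z t : (a z * b t) *: s z t = ((z == x) && (t == y))%:R *: s z t.
  have [c|] := boolP (central z || central t); first by rewrite s0// !scaler0.
  by rewrite negb_or => /andP[zc tc]; rewrite ax// bY// -natrM mulnb.
rewrite (bigD1 x)//= (bigD1 y)//= E !eqxx scale1r big1 => [|t /negbTE ty].
  rewrite big1 ?addr0// => z /negbTE zx; rewrite big1// => t _.
  by rewrite E zx scale0r.
by rewrite E ty andbF scale0r.
Qed.

Section QuadraticOperators.
Context {C : numFieldType} {V : lmodType C} {S : finType}.
Context (sf : rel S) (central : pred S) (mode : S -> int -> {linear V -> V}).
Context (sf_central : forall x y, central x -> sf x y = false)
        (sfC : symmetric sf)
        (car : forall x y i j v, mode x i (mode y j v) + mode y j (mode x i v)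
                                 = (sf x y && (i == - j - 1))%:R *: v)
        (smooth : forall v, exists B : nat,
                    forall x (p : nat), (B <= p)%N -> mode x p%:Z v = 0).

Local Notation m := #|S|.
Local Notation bn i j := (bnop central mode (enum_val i) (enum_val j)).
Implicit Types (M N : 'M[C]_m) (k l : int) (v : V).

Definition gram : 'M[C]_m := \matrix_(i, j) (sf (enum_val i) (enum_val j))%:R.

Lemma gramC i j : gram i j = gram j i.
Proof. by rewrite !mxE sfC. Qed.

Definition tsum (b : 'I_m -> 'I_m -> V) M : V := \sum_i \sum_j M i j *: b i j.

Lemma tsum_linear b : linear (tsum b).
Proof.
move=> a M N; rewrite /tsum scaler_sumr -big_split; apply: eq_bigr => i _ /=.
rewrite scaler_sumr -big_split; apply: eq_bigr => j _ /=.
by rewrite !mxE scalerDl scalerA.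
Qed.

HB.instance Definition _ b :=
  GRing.isLinear.Build C 'M[C]_m V *:%R (tsum b) (tsum_linear b).

Lemma tsum_delta b p q : tsum b (delta_mx p q) = b p q.
Proof.
rewrite /tsum (bigD1 p)//= (bigD1 q)//= mxE !eqxx scale1r big1 => [|j /negbTE jq].
  rewrite big1 ?addr0// => i /negbTE ip; rewrite big1// => j _.
  by rewrite mxE ip scale0r.
by rewrite mxE jq andbF scale0r.
Qed.

Lemma tsum_contract b M N :
  \sum_i \sum_j \sum_p \sum_q (M i j * N p q * gram j p) *: b i q
  = tsum b (M *m gram *m N).
Proof.
apply: eq_bigr => i _; rewrite exchange_big /=.
under eq_bigr do rewrite exchange_big /=.
rewrite exchange_big /=; apply: eq_bigr => q _.
rewrite mxE scaler_suml; apply: eq_bigr => p _.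
rewrite mxE mulr_suml scaler_suml; apply: eq_bigr => j _.
by rewrite mulrAC.
Qed.

Lemma tsumD b b' M : tsum (fun i j => b i j + b' i j) M = tsum b M + tsum b' M.
Proof.
rewrite /tsum -big_split; apply: eq_bigr => i _ /=.
by rewrite -big_split; apply: eq_bigr => j _ /=; rewrite scalerDr.
Qed.

Lemma tsum_gram a v M :
  tsum (fun i j => (a * gram i j) *: v) M = (a * \tr (M *m gram)) *: v.
Proof.
rewrite /tsum /mxtrace mulr_sumr scaler_suml; apply: eq_bigr => i _.
rewrite mxE mulr_sumr scaler_suml; apply: eq_bigr => j _.
by rewrite scalerA mulrCA gramC.
Qed.

(** The factor $1/2$ compensates for an antisymmetric tensor listing each product twice, as in
    [quad_delta]. *)
Definition quad M k v : V := 2^-1 *: tsum (fun i j => bn i j k v) M.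

Lemma quad_linearl k v : linear (fun M => quad M k v).
Proof. by move=> a M N; rewrite /= /quad tsum_linear scalerDr !scalerA mulrC. Qed.

Lemma quad_linear M k : linear (quad M k).
Proof.
move=> a u v; rewrite /quad scalerA mulrC -scalerA -scalerDr; congr (_ *: _).
rewrite /tsum scaler_sumr -big_split; apply: eq_bigr => i _ /=.
rewrite scaler_sumr -big_split; apply: eq_bigr => j _ /=.
by rewrite (bnop_linear _ smooth) scalerDr !scalerA mulrC.
Qed.

HB.instance Definition _ M k :=
  GRing.isLinear.Build C V V *:%R (quad M k) (quad_linear M k).

Lemma quad_delta p q k v : quad (delta_mx p q - delta_mx q p) k v = bn p q k v.
Proof.
rewrite /quad (linearB (tsum _)) /= !tsum_delta [X in _ - X](bnop_anti _ car smooth).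
by rewrite opprK -mulr2n -scaler_nat scalerA mulVf ?scale1r// pnatr_eq0.
Qed.

Lemma tsum_bnop_swap M N k l v :
  tsum (fun i j => bn i j k (tsum (fun p q => bn p q l v) N)) M
  - tsum (fun p q => bn p q l (tsum (fun i j => bn i j k v) M)) N
  = \sum_i \sum_j \sum_p \sum_q (M i j * N p q) *:
      (bn i j k (bn p q l v) - bn p q l (bn i j k v)).
Proof.
have bL i j p : linear (bn i j p) := bnop_linear _ smooth _ _ _.
have tsumL (f : V -> V) b A : linear f -> f (tsum b A) = tsum (fun i j => f (b i j)) A.
  move=> fL; pose g := HB.pack_for {linear V -> V} f (GRing.isLinear.Build _ _ _ _ _ fL).
  rewrite -[f]/(g : V -> V) /tsum linear_sum; apply: eq_bigr => i _.
  by rewrite linear_sum; apply: eq_bigr => j _; rewrite linearZ.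
have -> : tsum (fun i j => bn i j k (tsum (fun p q => bn p q l v) N)) M
  = \sum_i \sum_j \sum_p \sum_q (M i j * N p q) *: bn i j k (bn p q l v).
  apply: eq_bigr => i _; apply: eq_bigr => j _; rewrite tsumL// scaler_sumr.
  apply: eq_bigr => p _; rewrite scaler_sumr; apply: eq_bigr => q _.
  by rewrite scalerA.
have -> : tsum (fun p q => bn p q l (tsum (fun i j => bn i j k v) M)) N
  = \sum_i \sum_j \sum_p \sum_q (M i j * N p q) *: bn p q l (bn i j k v).
  under [RHS]eq_bigr do rewrite exchange_big /=.
  rewrite [RHS]exchange_big /=; apply: eq_bigr => p _.
  under [RHS]eq_bigr do rewrite exchange_big /=.
  rewrite [RHS]exchange_big /=; apply: eq_bigr => q _.
  rewrite tsumL// scaler_sumr; apply: eq_bigr => i _; rewrite scaler_sumr.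
  by apply: eq_bigr => j _; rewrite scalerA mulrC.
do 4!(rewrite -sumrB; apply: eq_bigr => ? _).
by rewrite scalerBr.
Qed.

(** Summing [bnop_bnop] over all entries contracts either index of [M] with an index of [N].
    Antisymmetry of [M] identifies the four contractions in pairs, giving twice $MJN-NJM$ and
    absorbing one of the two factors $1/2$. *)
Lemma quad_quad M N k l v : M^T = - M ->
  quad M k (quad N l v) - quad N l (quad M k v)
  = quad (mxlie gram M N) (k + l) v
    + ((k * (k == - l)%:Z)%:~R * (2^-1 * mxform gram M N)) *: v.
Proof.
move=> MT.
pose h : C := (k * (k == - l)%:Z)%:~R.
pose b (i j : 'I_m) := bn i j (k + l) v.
(* The scalar part of [bnop_bnop] is distributed over its first two contractions, the ones that
   produced it, so that it becomes a trace after summation. *)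
pose b1 (i j : 'I_m) := b i j + (h * gram i j) *: v.
have MTE i j : M i j = M^T j i by rewrite mxE.
have gE (i j : 'I_m) : (sf (enum_val i) (enum_val j))%:R = gram i j by rewrite mxE.
have E i j p q : (M i j * N p q) *: (bn i j k (bn p q l v) - bn p q l (bn i j k v))
  = (M i j * N p q * gram j p) *: b1 i q - (M^T j i * N p q * gram i p) *: b1 j q
    + (N p q * M^T j i * gram q j) *: b p i - (N p q * M i j * gram q i) *: b p j.
  rewrite (bnop_bnop sf_central sfC car smooth) !gE -/h -MTE.
  rewrite !(mulrC (N p q)) (gramC q j) (gramC q i) -!(scalerA (M i j * N p q)).
  rewrite -scalerBr -scalerDr -scalerBr; congr (_ *: _).
  rewrite /b1 mulrBr scalerBl !scalerDr !scalerA.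
  rewrite (mulrCA (gram j p)) (mulrCA (gram i p)); apply: esym.
  rewrite opprD addrACA -[LHS]addrA [LHS]addrAC.
  by congr (_ + _); rewrite addrA.
have -> : quad M k (quad N l v) - quad N l (quad M k v)
  = (2^-1 * 2^-1) *: (tsum b1 (M *m gram *m N) - tsum b1 (M^T *m gram *m N)
      + tsum b (N *m gram *m M^T) - tsum b (N *m gram *m M)).
  have LQ A a i u : quad A i (a *: u) = a *: quad A i u by rewrite linearZ.
  rewrite [in quad N l v]/quad [in quad M k v]/quad !LQ /quad !scalerA -scalerBr.
  congr (_ *: _); rewrite tsum_bnop_swap -4!tsum_contract.
  have X4 (G : 'I_m -> 'I_m -> 'I_m -> 'I_m -> V) :
      \sum_p \sum_q \sum_i \sum_j G i j p q = \sum_i \sum_j \sum_p \sum_q G i j p q.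
    under eq_bigr do rewrite exchange_big /=.
    rewrite exchange_big /=; apply: eq_bigr => i _.
    under eq_bigr do rewrite exchange_big /=.
    by rewrite exchange_big /=.
  have -> : \sum_p \sum_q \sum_j \sum_i (N p q * M^T j i * gram q j) *: b p i
    = \sum_i \sum_j \sum_p \sum_q (N p q * M^T j i * gram q j) *: b p i.
    apply: etrans (X4 (fun i j p q => _)); apply: eq_bigr => p _; apply: eq_bigr => q _.
    by rewrite exchange_big.
  have -> : \sum_j \sum_i \sum_p \sum_q (M^T j i * N p q * gram i p) *: b1 j q
    = \sum_i \sum_j \sum_p \sum_q (M^T j i * N p q * gram i p) *: b1 j q.
    by rewrite exchange_big.
  rewrite (X4 (fun i j p q => (N p q * M i j * gram q i) *: b p j)).
  do 4!(rewrite -sumrB -big_split -sumrB; apply: eq_bigr => ? _ /=).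
  exact: E.
have -> : M^T *m gram *m N = - (M *m gram *m N) by rewrite MT !mulNmx.
have -> : N *m gram *m M^T = - (N *m gram *m M) by rewrite MT mulmxN.
rewrite !(linearN (tsum _)) opprK -addrA addrACA -mulr2n -scaler_nat scalerA.
rewrite mulfVK ?pnatr_eq0// tsumD tsum_gram /quad (linearB (tsum _)) /=.
by rewrite addrAC scalerDr scalerA mulrCA /mxform !mulmxA.
Qed.
End QuadraticOperators.

(** * Representations of presented Lie algebras *)

Section LieEvaluation.
Context {K : fieldType} {X : Type} {V : lmodType K} (act : X -> V -> V).

(** Formal brackets become commutators of operators. Working on terms lets the defining relations be
    checked before passing to the quotient. *)
Fixpoint lie_eval (t : lie_term K X) (v : V) : V :=
  match t with
  | LGen x => act x v
  | LZero => 0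
  | LAdd t u => lie_eval t v + lie_eval u v
  | LScale a t => a *: lie_eval t v
  | LBr t u => lie_eval t (lie_eval u v) - lie_eval u (lie_eval t v)
  end.

Context (act_linear : forall x, linear (act x)).

Lemma lie_eval_linear t : linear (lie_eval t).
Proof.
elim: t => [x||t IHt u IHu|a t IHt|t IHt u IHu] b v w //=.
- exact: act_linear.
- by rewrite scaler0 addr0.
- by rewrite IHt IHu scalerDr addrACA.
- by rewrite IHt scalerDr !scalerA mulrC.
- by rewrite IHu IHt IHt IHu scalerBr opprD addrACA.
Qed.

HB.instance Definition _ t :=
  GRing.isLinear.Build K V V *:%R (lie_eval t) (lie_eval_linear t).

Context (rel : lie_term K X -> lie_term K X -> Prop)
        (rel_eval : forall t u, rel t u -> lie_eval t =1 lie_eval u).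

Lemma lie_cong_eval t u : lie_cong rel t u -> lie_eval t =1 lie_eval u.
Proof.
elim=> {t u} /=.
- exact: rel_eval.
- by [].
- by move=> t u _ IH v; rewrite IH.
- by move=> t u w _ IH _ IH' v; rewrite IH IH'.
- by move=> t t' u u' _ IHt _ IHu v; rewrite IHt IHu.
- by move=> a t t' _ IHt v; rewrite IHt.
- by move=> t t' u u' _ IHt _ IHu v; rewrite !IHt !IHu.
- by move=> t u w v; rewrite addrA.
- by move=> t u v; rewrite addrC.
- by move=> t v; rewrite add0r.
- by move=> t v; rewrite scaleN1r addNr.
- by move=> a b t v; rewrite scalerA.
- by move=> t v; rewrite scale1r.
- by move=> a t u v; rewrite scalerDr.
- by move=> a b t v; rewrite scalerDl.
- by move=> t u w v; rewrite linearD opprD addrACA.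
- by move=> t u w v; rewrite linearD opprD addrACA.
- by move=> a t u v; rewrite linearZ scalerBr.
- by move=> a t u v; rewrite linearZ scalerBr.
- by move=> t v; rewrite subrr.
- move=> t u w v; rewrite !(linearB (lie_eval _)) /=.
  (* Each of the six triple compositions occurs twice with opposite signs; once they are named, only
     an identity in an abelian group is left. *)
  pose e a b c := lie_eval a (lie_eval b (lie_eval c v)).
  rewrite -!/(e _ _ _); move: (e t u w) (e t w u) (e u t w) (e u w t) (e w t u) (e w u t).
  move=> p q r s x y.
  have -> : p - q - (s - y) + (s - r - (x - q)) = (p - x) + (y - r).
    by rewrite !opprB [s - r + _]addrC addrACA !subrKA.
  by rewrite opprB addrACA !subrKA subrr.
Qed.

(** By [lie_cong_eval] the result does not depend on the representative. *)
Definition lie_rho (x : presented_lie rel) (v : V) : V := lie_eval (lie_repr x) v.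

Lemma lie_rho_class t : lie_rho (lie_class rel t) = lie_eval t.
Proof. by apply/funext => v; apply: lie_cong_eval; exact: lie_repr_class. Qed.

Lemma lie_rho_rep : is_lie_rep lie_rho.
Proof.
split=> [x|v a|x y v]; first exact: lie_eval_linear.
  apply: pl_ind => x; apply: pl_ind => y.
  by rewrite pl_ZE pl_DE !lie_rho_class.
move: x y v; apply: pl_ind => x; apply: pl_ind => y v.
by rewrite [lie _ _]pl_brE !lie_rho_class.
Qed.

End LieEvaluation.

(** * The relations from Chevalley generators *)

Lemma cartan_diag ty n i : cartan ty n i i = 2.
Proof. by rewrite /cartan eqxx. Qed.

Lemma cartan_le0 ty n i j : i != j -> cartan ty n i j <= 0.
Proof. by move=> /negbTE ij; rewrite /cartan ij; case: ty; repeat case: ifP. Qed.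

(** No pair has $a_{ij}=a_{ji}=-2$. Hence $\alpha_i+\alpha_j$ has a nonzero value on $h_i$ or on
    $h_j$, as [root_form_same] requires. *)
Lemma cartan_diag_sum ty n i j : admissible ty n ->
  (2 + cartan ty n i j != 0) || (2 + cartan ty n j i != 0).
Proof.
case: ty; rewrite /admissible /cartan /chain !xpair_eqE => hn.
- by have [_|ij] := eqVneq i j; repeat case: ifP => ?; lia.
- by have [_|ij] := eqVneq i j; repeat case: ifP => ?; lia.
- by have [_|ij] := eqVneq i j; repeat case: ifP => ?; lia.
- by have [_|ij] := eqVneq i j; repeat case: ifP => ?; lia.
Qed.

(** The brackets of the $\alpha_i(k)$ come out with the uniform coefficient $a_{ij}\nu_j$. This
    lemma and the next four match it with the constants in relations 1 to 5 of the presentation. *)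
Lemma cartan_nu_00 ty n : admissible ty n ->
  2 * nu ty n 0 = (if ty is A2n then 2 else 2 * tw_order ty).
Proof. by case: ty; rewrite /nu /tw_order /admissible => hn; lia. Qed.

Lemma cartan_nu_0 ty n j : admissible ty n -> (0 < j <= n)%N ->
  cartan ty n 0 j * nu ty n j = (if ty is Dnp1 then 1 else tw_order ty) * cartan ty n 0 j.
Proof.
case: ty; rewrite /admissible /cartan /chain /nu /tw_order !xpair_eqE => hn hj.
all: by repeat case: ifP => ?; lia.
Qed.

Lemma cartan_nu_mid ty n i j : admissible ty n -> (0 < i <= j)%N -> (j <= n)%N ->
  (i, j) != (n.-1, n) -> (i, j) != (n, n) ->
  cartan ty n i j * nu ty n j = (if ty is Dnp1 then 1 else tw_order ty) * cartan ty n i j.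
Proof.
case: ty; rewrite /admissible /cartan /chain /nu /tw_order !xpair_eqE => hn hi hj ? ?.
all: by repeat case: ifP => ?; lia.
Qed.

Lemma cartan_nu_pred ty n : admissible ty n ->
  cartan ty n n.-1 n * nu ty n n = kappa ty * cartan ty n n.-1 n.
Proof.
case: ty; rewrite /admissible /kappa /cartan /chain /nu /tw_order !xpair_eqE => hn.
all: by repeat case: ifP => ?; lia.
Qed.

Lemma cartan_nu_last ty n : admissible ty n -> cartan ty n n n * nu ty n n = kappa' ty.
Proof.
case: ty; rewrite /admissible /kappa' /cartan /nu /tw_order eqxx => hn.
all: lia.
Qed.

Section ChevalleyGenerators.
Context {C : numFieldType} {V : lmodType C} {ty : ttype} {n m : nat}.
Context (J : 'M[C]_m) (op : 'M[C]_m -> int -> V -> V).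
Context (H : 'I_n.+1 -> 'M[C]_m) (X : bool -> 'I_n.+1 -> 'M[C]_m).
Context (n_ok : admissible ty n)
        (op_linear : forall M k, linear (op M k))
        (op_linearl : forall k v, linear (fun M => op M k v))
        (op_op : forall M N k l v, M^T = - M ->
           op M k (op N l v) - op N l (op M k v)
           = op (mxlie J M N) (k + l) v
             + ((k * (k == - l)%:Z)%:~R * (2^-1 * mxform J M N)) *: v)
        (HT : forall i, (H i)^T = - H i)
        (XT : forall s i, (X s i)^T = - X s i)
        (HX : forall s i j,
           mxlie J (H i) (X s j) = (pm s * cartan ty n i j)%:~R *: X s j)
        (XX : forall i j, mxlie J (X true i) (X false j) = (i == j)%:R *: H i)
        (XXform : forall i, 2^-1 * mxform J (X true i) (X false i) = (nu ty n i)%:~R).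

Local Notation a i j := (cartan ty n i j).

(** [H j] is the bracket of [X true j] and [X false j], whose weights under [H i] are opposite and
    cancel in the Jacobi identity. *)
Lemma cartan_comm i j : mxlie J (H i) (H j) = 0.
Proof.
have <- : mxlie J (X true j) (X false j) = H j by rewrite XX eqxx scale1r.
rewrite mxlie_jacobi !HX mxlieZl (linearZ_LR (mxlie J _)) /= -scalerDl -intrD.
by rewrite (_ : _ + _ = 0) ?scale0r//= /pm; lia.
Qed.

Lemma cartan_form i j : 2^-1 * mxform J (H i) (H j) = (a i j * nu ty n j)%:~R.
Proof.
have <- : mxlie J (X true j) (X false j) = H j by rewrite XX eqxx scale1r.
rewrite -mxform_lie HX mxformC mxformZr mxformC mulrCA XXform -intrM.
by rewrite /pm mul1r.
Qed.

(** Up to a nonzero factor [X s j] is its own bracket with [H j]; invariance moves [H j] onto [H i],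
    with which it commutes. *)
Lemma cartan_root_form s i j : mxform J (H i) (X s j) = 0.
Proof.
have : mxform J (H i) (mxlie J (H j) (X s j)) = 0.
  by rewrite -mxform_lie cartan_comm /mxform !mul0mx mxtrace0.
rewrite HX cartan_diag mxformZr => /eqP; rewrite mulf_eq0 intr_eq0.
by case: s => /= /eqP.
Qed.

(** Invariance under [H k]: the form pairs only opposite weights. *)
Lemma root_form_weight s t (i j k : 'I_n.+1) : (pm s * a k i + pm t * a k j != 0) ->
  mxform J (X s i) (X t j) = 0.
Proof.
move=> w0; apply/eqP; have := mxform_lie J (X s i) (H k) (X t j).
rewrite mxlie_anti !HX -scaleNr mxformC !mxformZr mxformC => /esym/eqP.
by rewrite -subr_eq0 -mulrBl opprK -intrD mulf_eq0 intr_eq0 addrC (negbTE w0).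
Qed.

Lemma root_form_same s i j : mxform J (X s i) (X s j) = 0.
Proof.
have /orP[w0|w0] := cartan_diag_sum i j n_ok.
  by apply: (@root_form_weight _ _ _ _ i); rewrite cartan_diag; move: w0; case: s => /=; lia.
by apply: (@root_form_weight _ _ _ _ j); rewrite cartan_diag; move: w0; case: s => /=; lia.
Qed.

Lemma root_form_opp i j : i != j -> mxform J (X true i) (X false j) = 0.
Proof.
move=> ij; apply: (@root_form_weight _ _ _ _ i); rewrite cartan_diag /=.
by have := @cartan_le0 ty n i j ij; lia.
Qed.

Lemma serre s (i j : 'I_n.+1) N : i != j -> N%:Z = 1 - a i j ->
  iter N (mxlie J (X s i)) (X s j) = 0.
Proof.
move=> ij; have ji : (j == i) = false by rewrite eq_sym (negbTE ij).
(* For the negative sign the $\mathfrak{sl}_2$-triple is $(f_i,e_i,-h_i)$. *)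
apply: (@mxlie_serre _ _ _ _ (X (~~ s) i) ((pm s)%:~R *: H i)).
- case: s; rewrite /= ?XX ?eqxx ?scale1r//.
  by rewrite mxlie_anti XX eqxx !scale1r scaleN1r.
- rewrite mxlieZl HX cartan_diag scalerA; congr (_ *: _).
  by case: s; rewrite /pm /=; ring.
- rewrite mxlieZl HX scalerA; congr (_ *: _).
  by case: s; rewrite /pm /= ?mulN1r ?mulrNz ?mulNr ?mul1r ?mulrN ?opprK.
- case: s; first by rewrite mxlie_anti XX ji scale0r oppr0.
  by rewrite XX (negbTE ij) scale0r.
Qed.

Lemma op0 k v : op 0 k v = 0.
Proof. by have := op_linearl k v (-1) 0 0; rewrite /= scaler0 addr0 scaleN1r addNr. Qed.

Lemma opZ b M k v : op (b *: M) k v = b *: op M k v.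
Proof. by have := op_linearl k v b M 0; rewrite /= op0 !addr0. Qed.

Definition t_act (g : t_gen n) : V -> V :=
  match g with Gc => id | Galpha i k => op (H i) k | GX s i k => op (X s i) k end.

Lemma t_act_linear g : linear (t_act g).
Proof. by case: g => [|i k|s i k] //=; exact: op_linear. Qed.

Lemma cartan_op i j k l v :
  op (H i) k (op (H j) l v) - op (H j) l (op (H i) k v)
  = ((a i j * nu ty n j) * k * delta k l)%:~R *: v.
Proof.
rewrite op_op// cartan_comm op0 add0r cartan_form -intrM; congr (_%:~R *: _).
by rewrite mulrC mulrA.
Qed.

Lemma t_rel_eval t u : t_rel ty t u -> lie_eval t_act t =1 lie_eval t_act u.
Proof.
case=> {t u} /=.
- by move=> t v; rewrite subrr.
- move=> k l v; rewrite cartan_op cartan_diag; congr (_%:~R *: _).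
  by rewrite cartan_nu_00.
- move=> j k l j0 v; rewrite cartan_op; congr (_%:~R *: _); congr (_ * _ * _).
  by apply: cartan_nu_0 => //; rewrite j0 -ltnS ltn_ord.
- move=> i j k l i0 ij ij1 ij2 v; rewrite cartan_op; congr (_%:~R *: _); congr (_ * _ * _).
  by apply: cartan_nu_mid => //; rewrite ?i0 // -ltnS ltn_ord.
- move=> i k l iN v; rewrite cartan_op; congr (_%:~R *: _); congr (_ * _ * _).
  by rewrite iN cartan_nu_pred.
- move=> k l v; rewrite cartan_op; congr (_%:~R *: _); congr (_ * _ * _).
  exact: cartan_nu_last.
- move=> s i j k l v; rewrite op_op// HX cartan_root_form opZ !mulr0 scale0r addr0.
  by [].
- move=> s i k l v; rewrite op_op// mxliexx op0 root_form_same !mulr0 scale0r addr0.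
  by [].
- move=> i j k l v; rewrite op_op// XX opZ.
  have [<-|ij] := eqVneq i j.
    rewrite XXform !scale1r -intrM; congr (_ + _%:~R *: _).
    by rewrite /delta; ring.
  by rewrite root_form_opp// !mulr0 !scale0r addr0.
- move=> s i j k1 ks ij sz v.
  (* This removes the scalar term at every stage, so the nested commutator of operators is a single
     mode of the nested bracket of tensors. For positive [p] it is invariance together with
     [mxliexx]. *)
  have F p : mxform J (X s i) (iter p (mxlie J (X s i)) (X s j)) = 0.
    case: p => [|p]; first exact: root_form_same.
    by rewrite /= -mxform_lie mxliexx /mxform !mul0mx mxtrace0.
  have [k E] : exists k, forall v, lie_eval t_act
        (foldl (fun t k => LBr (LGen (GX s i k)) t) (LGen (GX s j k1)) ks) v
      = op (iter (size ks) (mxlie J (X s i)) (X s j)) k v.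
    elim/last_ind: ks {sz} => [|ks k [l IH]]; first by exists k1.
    exists (k + l) => w; rewrite foldl_rcons size_rcons /= !IH.
    by rewrite op_op// F !mulr0 scale0r addr0.
  by rewrite E serre// op0.
Qed.

End ChevalleyGenerators.

(** * Operators on the Fock space *)

Section FockOperators.
Context {R : realType} {ty : ttype} {n : nat}.

Local Notation C := R[i].
Local Notation V := (fock R ty n).
Local Notation S := (symbol ty n).
Local Notation m := #|{: symbol ty n}|.
Implicit Types (x y z t : S) (a b : svect R ty n) (k : int) (v : V).

HB.instance Definition _ x j :=
  GRing.isLinear.Build C V V *:%R (smode x j : V -> V) (smode_linear x j).

Definition fmode x j : {linear V -> V} := smode x j.

Definition fop (M : 'M[C]_m) k v : V := quad (@is_c ty n) fmode M k v.

Local Notation J := (gram (C := C) (@sform ty n)).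

Lemma sform_c x y : is_c x -> sform x y = false.
Proof. by case: x y => [[a|a]|a] [[b|b]|b] //= /eqP ->. Qed.

Lemma fmode_car x y i j v :
  fmode x i (fmode y j v) + fmode y j (fmode x i v)
  = (sform x y && (i == - j - 1))%:R *: v.
Proof. exact: smode_car. Qed.

Lemma fmode_smooth v :
  exists B : nat, forall x (p : nat), (B <= p)%N -> fmode x p%:Z v = 0.
Proof. exact: annihilate_large. Qed.

Lemma fop_linear M k : linear (fop M k).
Proof. exact: quad_linear fmode_smooth M k. Qed.

Lemma fop_linearl k v : linear (fun M => fop M k v).
Proof. exact: quad_linearl. Qed.

Lemma fop_fop M N k l v : M^T = - M ->
  fop M k (fop N l v) - fop N l (fop M k v)
  = fop (mxlie J M N) (k + l) v
    + ((k * (k == - l)%:Z)%:~R * (2^-1 * mxform J M N)) *: v.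
Proof. exact: quad_quad sform_c (@sform_sym ty n) fmode_car fmode_smooth M N k l v. Qed.

Definition tensor x y : 'M[C]_m := delta_mx (enum_rank x) (enum_rank y).

(* Locked, as unification would otherwise see a sum of two matrices. *)
Definition wedge x y : 'M[C]_m := locked (tensor x y - tensor y x).

Lemma wedgeE x y : wedge x y = tensor x y - tensor y x.
Proof. by rewrite /wedge -lock. Qed.

Lemma wedge_tr x y : (wedge x y)^T = - wedge x y.
Proof. by rewrite wedgeE linearB /= !trmx_delta opprB. Qed.

(* The values of [a] on the symbols of c and c^* do not matter to [nop]. *)
Definition basic a x := forall z, ~~ is_c z -> a z = (z == x)%:R.

Lemma nop_wedge a b x y k v : basic a x -> basic b y ->
  nop a b k v = fop (wedge x y) k v.
Proof.
move=> ax bY.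
have -> : fop (wedge x y) k v = bnop (@is_c ty n) fmode x y k v.
  by rewrite /fop wedgeE (quad_delta _ fmode_car fmode_smooth) !enum_rankK.
apply: eq_fsbigr => i _.
apply: (@sum_indicator2 _ _ _ (@is_c ty n)) => // z t c; by rewrite /snop c.
Qed.

End FockOperators.

(** * Brackets, form and weights of elementary antisymmetric tensors *)

Section WedgeCalculus.
Context {R : realType} {ty : ttype} {n : nat}.

Local Notation C := R[i].
Local Notation S := (symbol ty n).
Local Notation J := (gram (C := C) (@sform ty n)).
Local Notation tensor := (@tensor R ty n).
Local Notation wedge := (@wedge R ty n).
Local Notation pr x y := ((sform x y)%:R : C).
Implicit Types (x y z t : S).

Lemma gramE x y : J (enum_rank x) (enum_rank y) = pr x y.
Proof. by rewrite mxE !enum_rankK. Qed.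

Lemma wedge_anti x y : wedge x y = - wedge y x.
Proof. by rewrite !wedgeE opprB. Qed.

Lemma tensor_gram_tensor x y z t : tensor x y *m J *m tensor z t = pr y z *: tensor x t.
Proof.
apply/matrixP => i j; rewrite mxE (bigD1 (enum_rank z))//= big1 => [|k /negbTE kz].
  rewrite mxE (bigD1 (enum_rank y))//= big1 => [|k /negbTE ky].
    rewrite gramE !mxE !eqxx andbT !addr0 /=.
    by rewrite -mulnb natrM mulrCA mulrA.
  by rewrite mxE ky andbF mul0r.
by rewrite [X in _ * X]mxE kz mulr0.
Qed.

Lemma mxlie_wedge x y z t :
  mxlie J (wedge x y) (wedge z t)
  = pr y z *: wedge x t - pr x z *: wedge y t
    + pr y t *: wedge z x - pr x t *: wedge z y.
Proof.
have T x' y' z' t' : mxlie J (tensor x' y') (tensor z' t')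
    = pr y' z' *: tensor x' t' - pr x' t' *: tensor z' y'.
  by rewrite /mxlie !tensor_gram_tensor (sform_sym t' x').
have B M : {morph mxlie J M : N P / N - P} by move=> N P; rewrite linearB.
rewrite !wedgeE mxlieDl mxlieNl !B !T; move: tensor => u.
by apply/matrixP => i j; rewrite !mxE; ring.
Qed.

Lemma mxform_wedge x y z t :
  2^-1 * mxform J (wedge x y) (wedge z t)
  = pr y z * pr x t - pr x z * pr y t.
Proof.
have F x' y' z' t' : mxform J (tensor x' y') (tensor z' t') = pr y' z' * pr x' t'.
  rewrite /mxform mulmxA tensor_gram_tensor -scalemxAl mxtraceZ; congr (_ * _).
  rewrite /mxtrace (bigD1 (enum_rank x'))//= big1 => [|i /negbTE ix].
    rewrite addr0 mxE (bigD1 (enum_rank t'))//= big1 => [|i /negbTE it].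
      by rewrite gramE mxE !eqxx mul1r addr0 sform_sym.
    by rewrite mxE it andbF mul0r.
  by rewrite mxE big1// => j _; rewrite mxE ix mul0r.
have D M N P : mxform J (M - N) P = mxform J M P - mxform J N P.
  by rewrite /mxform !mulmxBl linearB.
rewrite !wedgeE D !(mxformC _ _ (tensor z t - _)) !D !F.
rewrite (sform_sym t x) (sform_sym t y) (sform_sym z x) (sform_sym z y).
by rewrite -[RHS](mulKf (_ : 2 != 0)) ?pnatr_eq0//; congr (_ * _); ring.
Qed.

(** [M] acts diagonally in the basis of symbols, [d x] being the weight of the symbol [x]. *)
Definition weighted (M : 'M[C]_#|{: S}|) (d : S -> int) :=
  forall x y, mxlie J M (wedge x y) = (d x + d y)%:~R *: wedge x y.

(** Since [x] and [x'] pair only with each other, contracting one of them with a symbol puts the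
    same symbol back, up to sign. *)
Lemma weighted_wedge x x' :
  (forall y, sform x y -> y = x') -> (forall y, sform x' y -> y = x) ->
  weighted (wedge x x') (fun y => (sform x' y)%:Z - (sform x y)%:Z).
Proof.
move=> xx' x'x y z.
rewrite mxlie_wedge.
have E1 (w : S -> 'M[C]_#|{: S}|) u : pr x u *: w x' = pr x u *: w u.
  by case: (boolP (sform x u)) => [/xx' ->//|_]; rewrite !scale0r.
have E2 (w : S -> 'M[C]_#|{: S}|) u : pr x' u *: w x = pr x' u *: w u.
  by case: (boolP (sform x' u)) => [/x'x ->//|_]; rewrite !scale0r.
rewrite (E2 (wedge^~ z)) (E1 (wedge^~ z)) (E2 (wedge y)) (E1 (wedge y)).
rewrite -scalerBl -addrA -scalerBl -scalerDl; congr (_ *: _).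
by rewrite !rmorphD !rmorphN /= -!pmulrn.
Qed.

Lemma weightedD M N d e : weighted M d -> weighted N e ->
  weighted (M + N) (fun x => d x + e x).
Proof.
move=> Md Ne x y; rewrite mxlieDl Md Ne -scalerDl -intrD; congr (_%:~R *: _).
by rewrite addrACA.
Qed.

Lemma weightedZ c M d : weighted M d -> weighted (c%:R *: M) (fun x => c%:Z * d x).
Proof.
move=> Md x y; rewrite mxlieZl Md scalerA; congr (_ *: _).
by rewrite -mulrDr intrM.
Qed.

Definition pe (i : nat) : plabel n :=
  if i is j.+1 then omap inl (insub j) else None.
Definition pb (i : nat) : plabel n :=
  if i is j.+1 then omap inr (insub j) else None.

(* The symbols of [eps i], [eps i]^*, [epsb i], [epsb i]^* and of the ghosts,
   with the junk value [c] when the index is out of range. *)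
Definition e_ i : S := inl (inl (pe i)).
Definition es_ i : S := inl (inr (pe i)).
Definition b_ i : S := inl (inl (pb i)).
Definition bs_ i : S := inl (inr (pb i)).
Definition g_ g : S := if insub g is Some h then inr h else inl (inl None).

Lemma pform_pe i j : pform (pe i) (pe j) = (i == j) && (0 < i <= n)%N.
Proof.
case: i j => [|i] [|j] //=; rewrite /pform ?andbF//=.
  by case: insubP => //= u _ _; case: (_ == _).
case: insubP => [u iu ui|/negbTE iu]; last by rewrite /= iu andbF.
rewrite eqSS iu andbT /= -ui.
case: insubP => [v jv <-//|/negbTE jv] /=.
by apply/esym/negbTE/eqP => uj; rewrite -uj ltn_ord in jv.
Qed.
End WedgeCalculus.

(** * Pairings of the labelled symbols *)

Section Labels.
Context {R : realType} {ty : ttype} {n : nat}.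
Local Notation C := R[i].
Local Notation E i := (@e_ ty n i).
Local Notation Es i := (@es_ ty n i).
Local Notation B i := (@b_ ty n i).
Local Notation Bs i := (@bs_ ty n i).
Local Notation G i := (@g_ ty n i).

Lemma pform_pb i j : pform (@pb n i) (pb j) = (i == j) && (0 < i <= n)%N.
Proof.
rewrite -pform_pe; case: i j => [|i] [|j] //=; rewrite /pform /=;
  by do ?[case: insubP => [? ? ?|?] //=].
Qed.

Lemma pform_pepb i j : pform (@pe n i) (pb j) = false.
Proof.
case: i j => [|i] [|j] //=; rewrite /pform /=;
  by do ?[case: insubP => [? ? ?|?] //=].
Qed.

Lemma pform_pbpe i j : pform (@pb n i) (pe j) = false.
Proof.
case: i j => [|i] [|j] //=; rewrite /pform /=;
  by do ?[case: insubP => [? ? ?|?] //=].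
Qed.

Lemma sform_g a g : sform (G g) (inl a) = false.
Proof. by rewrite /g_; case: insubP => [? ? ?|?] //=; case: a. Qed.

Lemma sform_gr a g : sform (inl a) (G g) = false.
Proof. by rewrite sform_sym sform_g. Qed.

Lemma sform_gg g h : sform (G g) (G h)
  = [&& g < num_ghosts ty, h < num_ghosts ty
      & match ty with Dnp1 => g == h | A2n => g != h | _ => false end]%N.
Proof.
rewrite /g_; case: insubP => [u _ <-|/negbTE gu] /=; last by rewrite gu; case: insubP.
rewrite ltn_ord; case: insubP => [v _ <-|/negbTE hv] /=; last by rewrite hv.
by rewrite ltn_ord /ghost_form; case: ty u v.
Qed.

(** Bundled as a tuple so that a single [rewrite] evaluates every pairing of labels other than that
    of two ghosts. *)
Lemma sformE i j :
  ((sform (E i) (Es j) = (i == j) && (0 < i <= n)%N) *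
   (sform (Es i) (E j) = (i == j) && (0 < i <= n)%N) *
   (sform (B i) (Bs j) = (i == j) && (0 < i <= n)%N) *
   (sform (Bs i) (B j) = (i == j) && (0 < i <= n)%N)) *
  ((sform (E i) (E j) = false) * (sform (E i) (B j) = false) *
   (sform (E i) (Bs j) = false) * (sform (E i) (G j) = false) *
   (sform (Es i) (Es j) = false) * (sform (Es i) (B j) = false) *
   (sform (Es i) (Bs j) = false) * (sform (Es i) (G j) = false)) *
  ((sform (B i) (E j) = false) * (sform (B i) (Es j) = false) *
   (sform (B i) (B j) = false) * (sform (B i) (G j) = false) *
   (sform (Bs i) (E j) = false) * (sform (Bs i) (Es j) = false) *
   (sform (Bs i) (Bs j) = false) * (sform (Bs i) (G j) = false)) *
  ((sform (G i) (E j) = false) * (sform (G i) (Es j) = false) *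
   (sform (G i) (B j) = false) * (sform (G i) (Bs j) = false)).
Proof.
do !split; first [exact: pform_pe | exact: pform_pb | exact: pform_pepb
  | exact: pform_pbpe | exact: sform_g | exact: sform_gr | by []].
Qed.

Lemma eps_pe i (p : plabel n) : p != None -> (eps i : pvect R n) p = (p == pe i)%:R.
Proof.
case: p => [[j|j]|] // _; rewrite ffunE; case: i => [|i] //=.
  rewrite eqSS; case: insubP => [u _ ui|/negbTE iN] /=.
    by rewrite -ui; congr (nat_of_bool _)%:R; apply/eqP/eqP => [/val_inj ->|[->]].
  by case: eqP => // ji; rewrite -ji ltn_ord in iN.
by case: insubP.
Qed.

Lemma epsb_pb i (p : plabel n) : p != None -> (epsb i : pvect R n) p = (p == pb i)%:R.
Proof.
case: p => [[j|j]|] // _; rewrite ffunE; case: i => [|i] //=; first by case: insubP.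
rewrite eqSS; case: insubP => [u _ ui|/negbTE iN] /=.
  by rewrite -ui; congr (nat_of_bool _)%:R; apply/eqP/eqP => [/val_inj ->|[->]].
by case: eqP => // ji; rewrite -ji ltn_ord in iN.
Qed.

Lemma basic_vec (a : pvect R n) p :
  (forall q, q != None -> a q = (q == p)%:R) ->
  basic (vec a : svect R ty n) (inl (inl p)).
Proof. by move=> ap [[q|q]|g] /= qc; rewrite ffunE//= ap. Qed.

Lemma basic_star (a : pvect R n) p :
  (forall q, q != None -> a q = (q == p)%:R) ->
  basic (star a : svect R ty n) (inl (inr p)).
Proof. by move=> ap [[q|q]|g] /= qc; rewrite ffunE//= ap. Qed.

Lemma beta_pe (p : plabel n) : p != None -> beta R ty n p = (p == pe 1)%:R.
Proof.
move=> p0; rewrite -eps_pe// /beta ffunE.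
by case: ty; rewrite !ffunE (negbTE p0) ?scaler0 oppr0 add0r.
Qed.

Lemma basic_ghost g : basic (ghost g : svect R ty n) (G g).
Proof.
move=> [[q|q]|h] qc; rewrite ffunE /g_; case: insubP => [u _ ug|gN] //=.
- by case: eqP qc => // -[->].
- by rewrite -ug; congr (nat_of_bool _)%:R; apply/eqP/eqP => [/val_inj ->|[->]].
- by case: eqP => // hg; rewrite -hg ltn_ord in gN.
Qed.
End Labels.

(** * The generators as antisymmetric tensors *)

Section Generators.
Context {C : nzRingType} {L : lmodType C} (ty : ttype) (n : nat).
Context (W : symbol ty n -> symbol ty n -> L) (s2 w : C).
Local Notation E i := (@e_ ty n i).
Local Notation Es i := (@es_ ty n i).
Local Notation B i := (@b_ ty n i).
Local Notation Bs i := (@bs_ ty n i).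
Local Notation G i := (@g_ ty n i).

(** The formulas for the fields, with $\beta$ replaced by $\varepsilon_1$. The product [W] and the
    numbers [s2], [w] are parameters, so that the later evaluations use only $s_2^2=2$ and
    $w^2=-1-w$. *)
Definition gen_X0 (s : bool) :=
  match ty, s with
  | A2nm1, true => W (B 2) (Es 1) + W (Es 2) (B 1)
  | A2nm1, false => W (E 1) (Bs 2) + W (Bs 1) (E 2)
  | Dnp1, true => s2 *: W (G 1) (Es 1)
  | Dnp1, false => s2 *: W (E 1) (G 1)
  | A2n, true => W (B 1) (Es 1)
  | A2n, false => W (E 1) (Bs 1)
  | D4, true => W (B 1) (Es 1) + w *: W (Bs 1) (Es 1) + w ^+ 2 *: W (Bs 2) (Es 2)
  | D4, false => W (E 1) (Bs 1) + w ^+ 2 *: W (E 1) (B 1) + w *: W (E 2) (B 2)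
  end.

Definition gen_Xmid (s : bool) (i : nat) :=
  match ty, s with
  | A2nm1, true | A2n, true => W (E i) (Es i.+1) + W (Bs i) (B i.+1)
  | A2nm1, false | A2n, false => W (E i.+1) (Es i) + W (Bs i.+1) (B i)
  | Dnp1, true => W (E i) (Es i.+1)
  | Dnp1, false => W (E i.+1) (Es i)
  | D4, true => W (E 1) (Es 2) + W (B 2) (Bs 1) + W (B 2) (B 1)
  | D4, false => W (E 2) (Es 1) + W (B 1) (Bs 2) + W (Bs 1) (Bs 2)
  end.

Definition gen_Xn (s : bool) :=
  match ty, s with
  | A2nm1, true | D4, true => W (E n) (Bs n)
  | A2nm1, false | D4, false => W (B n) (Es n)
  | Dnp1, true => s2 *: W (E n) (G 0)
  | Dnp1, false => s2 *: W (G 0) (Es n)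
  | A2n, true => s2 *: (W (E n) (G 1) + W (Bs n) (G 0))
  | A2n, false => s2 *: (W (G 0) (Es n) + W (G 1) (B n))
  end.

(** In type [D4] the repeated summand comes once from $\varepsilon_1$ and once from $\beta$. *)
Definition gen_H0 :=
  match ty with
  | A2nm1 => W (Es 1) (E 1) + W (Es 2) (E 2) + W (B 1) (Bs 1) + W (B 2) (Bs 2)
  | Dnp1 => 2 *: W (Es 1) (E 1)
  | A2n => W (B 1) (Bs 1) + W (Es 1) (E 1)
  | D4 => W (Es 1) (E 1) + W (Es 1) (E 1) + W (Es 2) (E 2) + W (Bs 2) (B 2)
  end.

Definition gen_Hmid (i : nat) :=
  match ty with
  | A2nm1 | A2n =>
      W (E i) (Es i) + W (Es i.+1) (E i.+1) + W (Bs i) (B i) + W (B i.+1) (Bs i.+1)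
  | Dnp1 => W (E i) (Es i) + W (Es i.+1) (E i.+1)
  | D4 => W (E 1) (Es 1) + W (Es 2) (E 2) + 2 *: W (B 2) (Bs 2)
  end.

Definition gen_Hn :=
  match ty with
  | A2nm1 | D4 => W (E n) (Es n) + W (Bs n) (B n)
  | Dnp1 => 2 *: W (E n) (Es n)
  | A2n => 2 *: (W (E n) (Es n) + W (Bs n) (B n))
  end.

Definition gen_X (s : bool) (i : nat) :=
  if i == 0%N then gen_X0 s else if i == n then gen_Xn s else gen_Xmid s i.

Definition gen_H (i : nat) :=
  if i == 0%N then gen_H0 else if i == n then gen_Hn else gen_Hmid i.

End Generators.

Notation fock_X R ty n := (gen_X (@wedge R ty n) (csqrt R 2) (omega R)).
Notation fock_H R ty n := (gen_H (@wedge R ty n)).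

Definition represents R ty n (A : field R ty n) (M : 'M[R[i]]_#|{: symbol ty n}|) :=
  forall k v, A k v = fop M k v.

Section Representation.
Context {R : realType} {ty : ttype} {n : nat}.

Lemma represents_nop (a b : svect R ty n) x y : basic a x -> basic b y ->
  represents (nop a b) (wedge x y).
Proof. by move=> ax bY k v; exact: nop_wedge. Qed.

Lemma representsD (A B : field R ty n) M N :
  represents A M -> represents B N -> represents (A + B) (M + N).
Proof.
move=> AM BN k v; have := fop_linearl k v 1 M N; rewrite /= !scale1r => ->.
by rewrite -AM -BN.
Qed.

Lemma fop0 k v : fop (0 : 'M[R[i]]_#|{: symbol ty n}|) k v = 0.
Proof. by have := fop_linearl k v (-1) 0 0; rewrite /= scaler0 addr0 scaleN1r addNr. Qed.

Lemma representsZ (A : field R ty n) c M :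
  represents A M -> represents (c *: A) (c *: M).
Proof.
move=> AM k v; have := fop_linearl k v c M 0; rewrite /= fop0 !addr0 => ->.
by rewrite -AM.
Qed.
End Representation.

Ltac represent := first
  [ apply: representsD; represent
  | apply: representsZ; represent
  | apply: represents_nop; first
     [ apply: basic_vec; first [exact: beta_pe | exact: eps_pe | exact: epsb_pb]
     | apply: basic_star; first [exact: beta_pe | exact: eps_pe | exact: epsb_pb]
     | exact: basic_ghost ] ].

Lemma X_field_gen R ty n s (i : 'I_n.+1) : represents (X_field R ty s i) (fock_X R ty n s i).
Proof.
rewrite /X_field /gen_X; change (0%R : nat) with 0%N.
case: ifP => _; [|case: ifP => _].
- by rewrite /X0 /gen_X0; case: ty; case: s; represent.
- by rewrite /Xn /gen_Xn; case: ty; case: s; represent.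
- by rewrite /Xmid /gen_Xmid; case: ty; case: s; represent.
Qed.

Lemma alpha_field_gen R ty n (i : 'I_n.+1) : represents (alpha_field R ty i) (fock_H R ty n i).
Proof.
rewrite /alpha_field /gen_H; change (0%R : nat) with 0%N.
case: ifP => _; [|case: ifP => _].
- by rewrite /alpha0 /gen_H0; case: ty; represent.
- by rewrite /alphan /gen_Hn; case: ty; represent.
- by rewrite /alphamid /gen_Hmid; case: ty; represent.
Qed.

(** * Weights of the symbols under the Cartan elements *)

Section Weights.
Context (ty : ttype) (n : nat).
Implicit Types y : symbol ty n.
Local Notation E i := (@e_ ty n i).
Local Notation Es i := (@es_ ty n i).
Local Notation B i := (@b_ ty n i).
Local Notation Bs i := (@bs_ ty n i).

Definition dual_wt (x x' : symbol ty n) y : int := (sform x' y)%:Z - (sform x y)%:Z.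

(** Obtained from [gen_H] by replacing each product [W x x'] by the weight function that
    [weighted_wedge] attaches to it. *)
Definition gen_wt (i : nat) y : int :=
  if i == 0%N then
    match ty with
    | A2nm1 => dual_wt (Es 1) (E 1) y + dual_wt (Es 2) (E 2) y
               + dual_wt (B 1) (Bs 1) y + dual_wt (B 2) (Bs 2) y
    | Dnp1 => 2 * dual_wt (Es 1) (E 1) y
    | A2n => dual_wt (B 1) (Bs 1) y + dual_wt (Es 1) (E 1) y
    | D4 => dual_wt (Es 1) (E 1) y + dual_wt (Es 1) (E 1) y
            + dual_wt (Es 2) (E 2) y + dual_wt (Bs 2) (B 2) y
    end
  else if i == n then
    match ty with
    | A2nm1 | D4 => dual_wt (E n) (Es n) y + dual_wt (Bs n) (B n) y
    | Dnp1 => 2 * dual_wt (E n) (Es n) y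
    | A2n => 2 * (dual_wt (E n) (Es n) y + dual_wt (Bs n) (B n) y)
    end
  else
    match ty with
    | A2nm1 | A2n =>
        dual_wt (E i) (Es i) y + dual_wt (Es i.+1) (E i.+1) y
        + dual_wt (Bs i) (B i) y + dual_wt (B i.+1) (Bs i.+1) y
    | Dnp1 => dual_wt (E i) (Es i) y + dual_wt (Es i.+1) (E i.+1) y
    | D4 => dual_wt (E 1) (Es 1) y + dual_wt (Es 2) (E 2) y + 2 * dual_wt (B 2) (Bs 2) y
    end.
End Weights.

Lemma weighted_dual (R : realType) ty n (p : plabel n) :
  weighted (@wedge R ty n (inl (inl p)) (inl (inr p))) (dual_wt (inl (inl p)) (inl (inr p)))
  /\ weighted (@wedge R ty n (inl (inr p)) (inl (inl p))) (dual_wt (inl (inr p)) (inl (inl p))).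
Proof.
have l y : @sform ty n (inl (inl p)) y -> y = inl (inr p).
  by case: y => [[q|q]|g] //= /andP[_ /eqP ->].
have r y : @sform ty n (inl (inr p)) y -> y = inl (inl p).
  by case: y => [[q|q]|g] //= /andP[_ /eqP ->].
by split; apply: weighted_wedge.
Qed.

Lemma gen_H_weighted (R : realType) ty n i : weighted (fock_H R ty n i) (@gen_wt ty n i).
Proof.
have D p := (@weighted_dual R ty n p).1; have D' p := (@weighted_dual R ty n p).2.
have wD := @weightedD R ty n; have w2 := @weightedZ R ty n 2.
rewrite /gen_H /gen_H0 /gen_Hn /gen_Hmid => x y; rewrite /gen_wt.
case: ifP => _; [|case: ifP => _]; case: ty D D' wD w2 x y => D D' wD w2 x y.
- exact: (wD _ _ _ _ (wD _ _ _ _ (wD _ _ _ _ (D' _) (D' _)) (D _)) (D _)).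
- exact: (w2 _ _ (D' _)).
- exact: (wD _ _ _ _ (D _) (D' _)).
- exact: (wD _ _ _ _ (wD _ _ _ _ (wD _ _ _ _ (D' _) (D' _)) (D' _)) (D' _)).
- exact: (wD _ _ _ _ (D _) (D' _)).
- exact: (w2 _ _ (D _)).
- exact: (w2 _ _ (wD _ _ _ _ (D _) (D' _))).
- exact: (wD _ _ _ _ (D _) (D' _)).
- exact: (wD _ _ _ _ (wD _ _ _ _ (wD _ _ _ _ (D _) (D' _)) (D' _)) (D _)).
- exact: (wD _ _ _ _ (D _) (D' _)).
- exact: (wD _ _ _ _ (wD _ _ _ _ (wD _ _ _ _ (D _) (D' _)) (D' _)) (D _)).
- exact: (wD _ _ _ _ (wD _ _ _ _ (D _) (D' _)) (w2 _ _ (D _))).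
Qed.

Lemma gen_H_wedge (R : realType) ty n i (c : int) x y : gen_wt i x + gen_wt i y = c ->
  mxlie (gram (@sform ty n)) (fock_H R ty n i) (wedge x y) = c%:~R *: wedge x y.
Proof. by move=> <-; exact: gen_H_weighted. Qed.

Section Eigen.
Context {F : comNzRingType} {m : nat} (J H : 'M[F]_m) (c : F).
Lemma mxlie_eigenD M N : mxlie J H M = c *: M -> mxlie J H N = c *: N ->
  mxlie J H (M + N) = c *: (M + N).
Proof. by rewrite linearD scalerDr /= => -> ->. Qed.
Lemma mxlie_eigenZ a M : mxlie J H M = c *: M -> mxlie J H (a *: M) = c *: (a *: M).
Proof. by rewrite linearZ /= => ->; rewrite !scalerA mulrC. Qed.
End Eigen.

Lemma gen_wtE ty n i p :
  (@gen_wt ty n i (es_ p) = - @gen_wt ty n i (e_ p)) *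
  (@gen_wt ty n i (bs_ p) = - @gen_wt ty n i (b_ p)) * (@gen_wt ty n i (g_ p) = 0).
Proof.
rewrite /gen_wt; case: ty; do !split.
all: by case: ifP => _; [|case: ifP => _]; rewrite /dual_wt !sformE; ring.
Qed.

(** Together with [gen_wtE], this expresses every weight in these two types through those of the
    symbols [e_ p]. *)
Lemma gen_wt_b n i p :
  (@gen_wt A2nm1 n i (b_ p) = - @gen_wt A2nm1 n i (e_ p)) *
  (@gen_wt A2n n i (b_ p) = - @gen_wt A2n n i (e_ p)).
Proof.
split; rewrite /gen_wt; case: ifP => _; [|case: ifP => _| |case: ifP => _].
all: by rewrite /dual_wt !sformE; ring.
Qed.

(** The left side is the common weight of the summands of $X(\alpha_j)$, written through the symbols
    [e_ p]. In type [D4] barred symbols have independent weights, and [gen_HX] treats that case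
    directly. *)
Lemma gen_wt_cartan ty n i j :
  admissible ty n -> ty <> D4 -> (i <= n)%N -> (j <= n)%N ->
  let f p := @gen_wt ty n i (e_ p) in
  (if j == 0%N then
     match ty with A2nm1 => - f 1 - f 2 | Dnp1 => - f 1 | _ => - f 1 - f 1 end
   else if j == n then if ty is A2nm1 then f n + f n else f n
   else f j - f j.+1) = cartan ty n i j.
Proof.
rewrite /gen_wt /cartan /chain /admissible !xpair_eqE => + + iN jN.
case: (eqVneq i 0%N) => [i0|i0]; [|case: (eqVneq i n) => [iN'|iN']];
  (case: (eqVneq j 0%N) => [j0|j0]; [|case: (eqVneq j n) => [jN'|jN']]);
  case: ty => // n_ok _.
all: rewrite /dual_wt !sformE ?i0 ?j0 ?iN' ?jN' /=.
all: repeat case: ifP => ?; try lia.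
Qed.

Lemma gen_HX (R : realType) ty n s i j :
  admissible ty n -> (i <= n)%N -> (j <= n)%N ->
  mxlie (gram (@sform ty n)) (fock_H R ty n i) (fock_X R ty n s j)
  = (pm s * cartan ty n i j)%:~R *: fock_X R ty n s j.
Proof.
move=> n_ok iN jN.
have rootP x y c : gen_wt i x + gen_wt i y = pm s * c ->
    mxlie (gram (@sform ty n)) (fock_H R ty n i) (wedge x y) = (pm s * c)%:~R *: wedge x y.
  exact: gen_H_wedge.
have K := @gen_wt_cartan ty n i j n_ok.
case: ty n_ok iN jN K rootP => n_ok iN jN K rootP; last first.
  (* Type [D4] has [n = 2], so the pairs of indices form a finite list and each weight is computed
     outright. *)
  { move/eqP: n_ok iN jN rootP {K} => -> iN jN rootP.
    case: i j iN jN rootP => [|[|[|i]]] // [|[|[|j]]] // _ _ rootP; rewrite /gen_X /=.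
    all: rewrite /gen_X0 /gen_Xn /gen_Xmid; case: s rootP => rootP.
    all: repeat first [apply: rootP | apply: mxlie_eigenD | apply: mxlie_eigenZ].
    all: by rewrite /gen_wt /dual_wt ?sformE. }
all: move: (K ltac:(discriminate) iN jN) => /=; rewrite /gen_X.
all: case: eqP => [->|_]; [|case: eqP => [->|_]] => <-.
all: rewrite /gen_X0 /gen_Xn /gen_Xmid; case: s rootP => rootP.
(* Each summand of the root vector is an eigenvector for the same eigenvalue, so only weights remain
   to be compared. *)
all: repeat first [apply: rootP | apply: mxlie_eigenD | apply: mxlie_eigenZ].
all: rewrite ?gen_wtE ?gen_wt_b /pm; ring.
Qed.

(* Decides or splits the comparisons of indices in the goal.  As the types
   depend on [n], an index equal to [n] is replaced by [n], not conversely. *)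
Ltac nat_split n :=
  match goal with
  | |- context [leq ?a ?b] =>
      first [ rewrite (_ : leq a b = true); last by lia
            | rewrite (_ : leq a b = false); last by lia ]
  | |- context [?a.+1 == ?b.+1] => rewrite (eqSS a b)
  | |- context [@eq_op _ ?a ?b] =>
      first [ rewrite (_ : (a == b) = true); last by lia
            | rewrite (_ : (a == b) = false); last by lia
            | let e := fresh "e" in
              case: (eqVneq a b) => e;
              [ first [ subst a | subst b | constr_eq b n; rewrite ?e
                      | constr_eq a n; rewrite -?e ] | ] ]
  end.

(* [phi] stands for a matrix entry of the twisted commutator or for the
   invariant form: once the values are scalars, [ring] applies. *)
Section BilinearEvaluation.
Context {C : comNzRingType} {L : lmodType C} (ty : ttype) (n : nat).
Context (n_ok : admissible ty n).
Context (W : symbol ty n -> symbol ty n -> L) (s2 w : C) (s2K : s2 * s2 = 2)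
        (w2 : w ^+ 2 = - 1 - w).
Context (phi : L -> L -> C)
        (bDl : forall u u' v, phi (u + u') v = phi u v + phi u' v)
        (bDr : forall u v v', phi u (v + v') = phi u v + phi u v')
        (bZl : forall a u v, phi (a *: u) v = a * phi u v)
        (bZr : forall a u v, phi u (a *: v) = a * phi u v).
Local Notation pr x y := ((sform x y)%:R : C).
Local Notation X := (gen_X W s2 w).

Lemma gen_XX_eval (T : symbol ty n -> symbol ty n -> C) (f : L -> C) i j :
  (forall u v, f (u + v) = f u + f v) -> (forall a u, f (a *: u) = a * f u) ->
  (forall x y, f (W x y) = T x y - T y x) ->
  (forall x y z t, phi (W x y) (W z t)
    = pr y z * (T x t - T t x) - pr x z * (T y t - T t y)
      + pr y t * (T z x - T x z) - pr x t * (T z y - T y z)) ->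
  (i <= n)%N -> (j <= n)%N ->
  phi (X true i) (X false j) = (i == j)%:R * f (gen_H W i).
Proof.
move=> fD fZ fW bW iN jN.
have ww2 : w * w ^+ 2 = 1 by rewrite w2 mulrBr mulrN mulr1 -expr2 w2; ring.
have w2w : w ^+ 2 * w = 1 by rewrite mulrC.
rewrite /gen_X /gen_H.
case: (eqVneq i 0%N) => [i0|i0]; rewrite ?i0; [|case: (eqVneq i n) => [ni|ni]; rewrite ?ni];
  (case: (eqVneq j 0%N) => [j0|j0]; rewrite ?j0; [|case: (eqVneq j n) => [nj|nj]; rewrite ?nj]).
all: rewrite /gen_X0 /gen_Xn /gen_Xmid /gen_H0 /gen_Hn /gen_Hmid.
all: move: (n_ok); rewrite /admissible.
all: case: (ty) W T fW bW => W' T' fW bW ok.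
all: rewrite ?(bDl, bDr, bZl, bZr) !bW ?(fD, fZ) ?fW.
(* In type [D4], [n] is replaced by 2 only as an index of a label, since the type of the symbols
   itself depends on [n]. *)
all: try (move/eqP: ok => ok; rewrite ?(congr1 (@e_ D4 n) ok) ?(congr1 (@es_ D4 n) ok)
                                      ?(congr1 (@b_ D4 n) ok) ?(congr1 (@bs_ D4 n) ok)).
all: rewrite ?sformE ?sform_gg /=.
all: repeat nat_split n.
all: rewrite -?(mulrDr s2) ?(mulrA s2 s2) ?s2K ?(mulrA w (w ^+ 2)) ?(mulrA (w ^+ 2) w)
             ?ww2 ?w2w ?w2 /=.
all: ring.
Qed.
Lemma gen_form_eval i :
  (forall x y z t, phi (W x y) (W z t) = pr y z * pr x t - pr x z * pr y t) ->
  (i <= n)%N -> phi (X true i) (X false i) = (nu ty n i)%:~R.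
Proof.
move=> bW iN.
have ww2 : w * w ^+ 2 = 1 by rewrite w2 mulrBr mulrN mulr1 -expr2 w2; ring.
have w2w : w ^+ 2 * w = 1 by rewrite mulrC.
rewrite /gen_X /nu.
case: (eqVneq i 0%N) => [i0|i0]; rewrite ?i0; [|case: (eqVneq i n) => [ni|ni]; rewrite ?ni].
all: rewrite /gen_X0 /gen_Xn /gen_Xmid.
all: move: (n_ok); rewrite /admissible.
all: case: (ty) W bW => W' bW ok.
all: rewrite ?(bDl, bDr, bZl, bZr) !bW ?sformE ?sform_gg /tw_order /=.
all: repeat nat_split n.
all: rewrite -?(mulrDr s2) ?(mulrA s2 s2) ?s2K ?(mulrA w (w ^+ 2)) ?(mulrA (w ^+ 2) w)
             ?ww2 ?w2w ?w2 /=.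
all: ring.
Qed.
End BilinearEvaluation.

(** * The level, and the irrational coefficients *)

Section LevelElement.
Context {C : numFieldType} {m : nat} {ty : ttype} {n : nat}.
Context (W : symbol ty n -> symbol ty n -> 'M[C]_m).
Context (W_anti : forall x y, W x y = - W y x).

Definition c1_coef (i : nat) : C :=
  match ty with
  | A2nm1 => if (i < 2)%N then 1 else 2
  | Dnp1 => if (i == 0%N) || (i == n) then 1 else 2
  | A2n => if i == n then 2^-1 else 1
  | D4 => i.+1%:R
  end.

(** The middle tensors are differences [g i - g i.+1], or [d i - d i.+1] in type [Dnp1], so their
    sum telescopes and what is left cancels against the end nodes. In type [D4] the three terms are
    added directly. *)
Lemma gen_H_level : admissible ty n -> \sum_(i < n.+1) c1_coef i *: gen_H W i = 0.
Proof.
pose d p := W (@e_ ty n p) (es_ p).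
pose g p := d p - W (@b_ ty n p) (bs_ p).
have T (f : nat -> 'M[C]_m) a : (a <= n)%N -> \sum_(a <= i < n) (f i - f i.+1) = f a - f n.
  move=> an; rewrite -opprB -(telescope_sumr _ an) -sumrN.
  by apply: eq_bigr => i _; rewrite opprB.
have Wd p : W (e_ p) (es_ p) = d p by [].
have We p : W (es_ p) (e_ p) = - d p by exact: W_anti.
have Wb p : W (b_ p) (bs_ p) = d p - g p by rewrite subKr.
have Wbs p : W (bs_ p) (b_ p) = g p - d p by rewrite W_anti Wb opprB.
rewrite -(big_mkord xpredT (fun i => c1_coef i *: gen_H W i)) big_nat_recr//= /c1_coef /gen_H.
rewrite /gen_H0 /gen_Hn /gen_Hmid /admissible eqxx.
clearbody d g; move: (W) Wd We Wb Wbs; case: (ty) => U Ud We Wb Wbs hn.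
- rewrite big_ltn; last by lia. rewrite big_ltn; last by lia.
  rewrite (eq_big_nat _ _ (F2 := fun i => 2 *: (g i - g i.+1))) => [|i hi]; last first.
    rewrite !ifF ?Ud ?We ?Wb ?Wbs; try lia.
    by apply/matrixP => p q; rewrite !mxE /=; ring.
  rewrite -scaler_sumr T; last by lia.
  rewrite eqxx !ifF ?Ud ?We ?Wb ?Wbs; try lia.
  by apply/matrixP => p q; rewrite !mxE /=; ring.
- rewrite big_ltn; last by lia.
  rewrite (eq_big_nat _ _ (F2 := fun i => 2 *: (d i - d i.+1))) => [|i hi]; last first.
    by rewrite !ifF ?Ud ?We; try lia.
  rewrite -scaler_sumr T; last by lia.
  rewrite eqxx ?orbT !ifF ?Ud ?We ?Wb ?Wbs; try lia.
  by apply/matrixP => p q; rewrite !mxE /=; ring.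
- rewrite big_ltn; last by lia.
  rewrite (eq_big_nat _ _ (F2 := fun i => g i - g i.+1)) => [|i hi]; last first.
    rewrite !ifF ?Ud ?We ?Wb ?Wbs; try lia.
    by apply/matrixP => p q; rewrite !mxE /=; ring.
  rewrite T; last by lia.
  rewrite !ifF ?Ud ?We ?Wb ?Wbs; try lia.
  by apply/matrixP => p q; rewrite !mxE /=; field.
- rewrite big_ltn; last by lia. rewrite big_ltn; last by lia. rewrite big_geq; last by lia.
  have n2 : n = 2 by apply/eqP.
  rewrite (congr1 (@e_ D4 n) n2) (congr1 (@es_ D4 n) n2) (congr1 (@b_ D4 n) n2)
          (congr1 (@bs_ D4 n) n2).
  rewrite !ifF ?Ud ?We ?Wb ?Wbs; try lia.
  rewrite (_ : n.+1%:R = 3); last by rewrite {1}n2.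
  by apply/matrixP => p q; rewrite !mxE /=; ring.
Qed.
End LevelElement.

Lemma csqrt2K (R : realType) : csqrt R 2 * csqrt R 2 = 2.
Proof.
rewrite /csqrt -rmorphM /= -expr2 sqr_sqrtr ?ler0n//.
by rewrite rmorph_nat.
Qed.

Lemma omega2 (R : realType) : omega R ^+ 2 = - 1 - omega R.
Proof.
pose t : R := 2 * pi / 3.
have s0 : 0 < sin t.
  apply: sin_gt0_pi; apply/andP; split.
    by rewrite /t divr_gt0// mulr_gt0// pi_gt0.
  by rewrite /t ltr_pdivrMr// mulrC ltr_pM2l ?pi_gt0// ltr_nat.
have t3 : t + t + t = pi + pi by rewrite /t; field.
have := cosD (t + t) t; have := sinD (t + t) t; have := cos2Dsin2 t.
rewrite t3 (cosD t t) (sinD t t) (cosD pi) (sinD pi) sinpi cospi => cs s3 c3.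
(* With $3t=2\pi$, dividing $\sin 3t=0$ by $\sin t>0$ gives this relation. Then $\cos^2 t=1/4$, and
   $\cos 3t=1$ fixes the sign of $\cos t$. *)
have s2E : sin t ^+ 2 = 3 * cos t ^+ 2.
  apply/eqP; rewrite -subr_eq0; apply/eqP/(mulfI (lt0r_neq0 s0)).
  apply: oppr_inj; rewrite mulr0 oppr0; move: s3; rewrite mulr0 mul0r addr0 => s3.
  by rewrite [RHS]s3; ring.
have c2E : cos t ^+ 2 = 4^-1 by move: cs; rewrite s2E => cs; lra.
have cE : cos t = - 2^-1.
  have : cos t * (cos t ^+ 2 - 3 * sin t ^+ 2) = 1.
    by apply: etrans (_ : -1 * -1 - 0 * 0 = 1); [rewrite c3|]; ring.
  by rewrite s2E c2E => ?; lra.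
rewrite /omega -/t; apply/eqP; rewrite eq_complex /= -/t cE; apply/andP; split; apply/eqP.
  by rewrite -!expr2 s2E c2E sqrrN exprVn; field.
by field.
Qed.

(** * The representation *)

Lemma trmx_antiD (F : pzRingType) m (M N : 'M[F]_m) :
  M^T = - M -> N^T = - N -> (M + N)^T = - (M + N).
Proof. by move=> MT NT; rewrite linearD /= MT NT opprD. Qed.

Lemma trmx_antiZ (F : pzRingType) m a (M : 'M[F]_m) : M^T = - M -> (a *: M)^T = - (a *: M).
Proof. by move=> MT; rewrite linearZ /= MT scalerN. Qed.

Section FockAlgebra.
Context {R : realType} {ty : ttype} {n : nat} (n_ok : admissible ty n).
Local Notation C := R[i].
Local Notation J := (gram (C := C) (@sform ty n)).
Local Notation m := #|{: symbol ty n}|.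
Local Notation X := (fock_X R ty n).
Local Notation H := (fock_H R ty n).
Implicit Types M N P : 'M[C]_m.

Lemma fock_XT s i : (X s i)^T = - X s i.
Proof.
rewrite /gen_X /gen_X0 /gen_Xn /gen_Xmid.
case: ifP => _; [|case: ifP => _]; case: (ty); case: s.
all: by repeat first [apply: wedge_tr | apply: trmx_antiD | apply: trmx_antiZ].
Qed.

Lemma fock_HT i : (H i)^T = - H i.
Proof.
rewrite /gen_H /gen_H0 /gen_Hn /gen_Hmid.
case: ifP => _; [|case: ifP => _]; case: (ty).
all: by repeat first [apply: wedge_tr | apply: trmx_antiD | apply: trmx_antiZ].
Qed.

Lemma fock_XX i j : (i <= n)%N -> (j <= n)%N ->
  mxlie J (X true i) (X false j) = (i == j)%:R *: H i.
Proof.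
move=> iN jN; apply/matrixP => p q; rewrite [RHS]mxE.
apply: (@gen_XX_eval _ _ _ _ n_ok _ _ _ (csqrt2K R) (omega2 R)
  (fun M N => mxlie J M N p q) _ _ _ _ (fun x y => tensor x y p q) (fun M => M p q)) => //.
- by move=> M M' N; rewrite mxlieDl mxE.
- by move=> M N N'; rewrite linearD mxE.
- by move=> a M N; rewrite mxlieZl mxE.
- by move=> a M N; rewrite linearZ mxE.
- by move=> M N; rewrite mxE.
- by move=> a M; rewrite mxE.
- by move=> x y; rewrite wedgeE !mxE.
- move=> x y z t; rewrite mxlie_wedge !wedgeE.
  by move: (@tensor R ty n) => u; rewrite !mxE.
Qed.

Lemma fock_XXform i : (i <= n)%N ->
  2^-1 * mxform J (X true i) (X false i) = (nu ty n i)%:~R.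
Proof.
move=> iN; have Dl M M' N : mxform J (M + M') N = mxform J M N + mxform J M' N.
  by rewrite /mxform !mulmxDl linearD.
apply: (@gen_form_eval _ _ _ _ n_ok _ _ _ (csqrt2K R) (omega2 R)
  (fun M N => 2^-1 * mxform J M N)) => //.
- by move=> M M' N; rewrite Dl mulrDr.
- by move=> M N N'; rewrite !(mxformC _ M) Dl mulrDr.
- by move=> a M N; rewrite mxformC mxformZr mulrCA mxformC.
- by move=> a M N; rewrite mxformZr mulrCA.
- exact: mxform_wedge.
Qed.

End FockAlgebra.

Lemma linear_app_sum (K : fieldType) (L V : lmodType K) (f : L -> V) (I : finType)
    (c : I -> K) (u : I -> L) : linear f ->
  f (\sum_i c i *: u i) = \sum_i c i *: f (u i).
Proof.
move=> fL; pose g := HB.pack_for {linear L -> V} f (GRing.isLinear.Build _ _ _ _ _ fL).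
by rewrite -[f]/(g : L -> V) linear_sum; apply: eq_bigr => i _; rewrite linearZ.
Qed.

Theorem theorem4p1 (R : realType) (ty : ttype) (n : nat) (hn : admissible ty n) :
  exists rho : t_alg R ty n -> fock R ty n -> fock R ty n,
    [/\ is_lie_rep rho,
        forall v, rho (t_c R ty n) v = v,
        forall (i : 'I_n.+1) (k : int),
          rho (t_alpha R ty i k) = alpha_field R ty i k,
        forall (s : bool) (i : 'I_n.+1) (k : int),
          rho (t_X R ty s i k) = X_field R ty s i k
      & is_level_1_0 rho].
Proof.
have le_n (i : 'I_n.+1) : (i <= n)%N by rewrite -ltnS.
pose act := @t_act R[i] (fock R ty n) n _ (@fop R ty n)
  (fun i => fock_H R ty n i) (fun s i => fock_X R ty n s i).
have act_linear x : linear (act x) by apply: t_act_linear; exact: fop_linear.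
have rel_eval t u : t_rel ty t u -> lie_eval act t =1 lie_eval act u.
  apply: (t_rel_eval hn (@fop_linearl R ty n) (@fop_fop R ty n)).
  - by move=> i; exact: fock_HT.
  - by move=> s i; exact: fock_XT.
  - by move=> s i j; apply: gen_HX.
  - by move=> i j; apply: fock_XX.
  - by move=> i; apply: fock_XXform.
pose rho := lie_rho (rel := @t_rel R[i] ty n) act.
have rhoE g : rho (pl_gen _ g) = act g by exact: (lie_rho_class act_linear rel_eval).
have rho_rep : is_lie_rep rho by exact: lie_rho_rep.
have rho_c v : rho (t_c R ty n) v = v by rewrite rhoE.
have rho_alpha i k : rho (t_alpha R ty i k) = alpha_field R ty i k.
  by rewrite rhoE; apply/funext => v; rewrite alpha_field_gen.
exists rho; split=> // [s i k|].
  by rewrite rhoE; apply/funext => v; rewrite X_field_gen.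
split=> // v; case: rho_rep => _ rho_linear _.
(* $c_1$ acts by the zero mode of a combination of the tensors of the $\alpha_i(z)$, and by
   [gen_H_level] this combination already vanishes as a tensor. *)
rewrite (linear_app_sum _ _ (rho_linear v)).
under eq_bigr do rewrite rho_alpha alpha_field_gen.
rewrite -(linear_app_sum (f := fun M => fop M 0 v)); last exact: fop_linearl.
rewrite [X in fop X](_ : _ = 0) ?fop0//.
exact: (gen_H_level (@wedge_anti R ty n) hn).
Qed.
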